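(* Let $X$ and $U$ be Banach spaces, let $\tau>0$, let $A$ be the generator of a strongly continuous semigroup $T(t)$ on $X$, and let $B_0:U\to X$ and $F:X\to U$ be bounded linear operators. Let $\omega\in\mathbb{R}$ and suppose that the nominal sampled-data system $$\dot x(t)=Ax(t)+B_0u(t)\quad \forall t\ge 0,\qquad x(0)=x^0\in X,\qquad u(k\tau+t)=Fx(k\tau)\quad \forall t\in[0,\tau),\ \forall k\in\mathbb{Z}_+,$$ is exponentially stable with decay rate greater than $\omega$. Let $t_0>0$ be arbitrary. Then there exists $0<q<1$ such that for every bounded linear operator $D:X_1\to X$ satisfying $$\int_0^{t_0}\|DT(s)x\|\,ds\le q\|x\|\qquad \forall x\in\mathrm{dom}(A),$$ the perturbed sampled-data system $$\dot x(t)=(A+D)x(t)+B_0u(t)\quad \forall t\ge 0,\qquad x(0)=x^0\in X,\qquad u(k\tau+t)=Fx(k\tau)\quad \forall t\in[0,\tau),\ \forall k\in\mathbb{Z}_+,$$ is also exponentially stable with decay rate greater than $\omega$.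
   Context: $\mathbb{Z}_+$ is the set of nonnegative integers. $X_1$ denotes the Banach space $(\mathrm{dom}(A),\|\cdot\|_A)$ with the graph norm $\|x\|_A:=\|x\|+\|Ax\|$. Set $B:=B_0F$, a bounded linear operator on $X$. Solution: if $G$ is the generator of a strongly continuous semigroup $S(t)$ on $X$, the solution of the sampled-data system with generator $G$ (i.e. $\dot x=Gx+B_0u$, $u(k\tau+t)=Fx(k\tau)$ for $t\in[0,\tau)$, $k\in\mathbb{Z}_+$) and initial state $x^0\in X$ is the function $x:[0,\infty)\to X$ defined recursively by $x(0)=x^0$ and $$x(k\tau+t)=S(t)x(k\tau)+\int_0^t S(s)Bx(k\tau)\,ds\qquad \forall t\in(0,\tau],\ \forall k\in\mathbb{Z}_+.$$ The nominal system corresponds to $G=A$, $S=T$. The perturbed system corresponds to $G=A+D$ with $\mathrm{dom}(A+D):=\mathrm{dom}(A)$ and $S=T_D$, the strongly continuous semigroup generated by $A+D$. (Under the stated integral condition with $q<1$, $A+D$ generates a strongly continuous semigroup by the Miyadera–Voigt perturbation theorem.) Exponential stability: the sampled-data system is exponentially stable with decay rate greater than $\omega$ if there exist $M\ge1$ and $\widetilde\omega>\omega$ such that for all $x^0\in X$ the solution satisfies $\|x(t)\|\le Me^{-\widetilde\omega t}\|x^0\|$ for all $t\ge0$. *)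

(* Defs.v *)
From Stdlib Require Import Reals.
From Coquelicot Require Import Coquelicot.

Open Scope R_scope.

(* Banach spaces are [CompleteNormedModule R_AbsRing].  Complex Banach spaces
   are covered by restriction of scalars: domains, generators, integrals and
   estimates below do not depend on the scalar field, and complex-linear
   operators are real-linear. *)

(* Values of [op_app] outside [op_dom] are junk and are never used. *)
Record operator (X : CompleteNormedModule R_AbsRing) := Operator {
  op_dom : X -> Prop;
  op_app : X -> X
}.
Arguments Operator {X} _ _.
Arguments op_dom {X} _ _.
Arguments op_app {X} _ _.

(* Coquelicot's [is_linear] includes boundedness.  Only the values S t with
   0 <= t are constrained or used. *)
Record C0_semigroup {X : CompleteNormedModule R_AbsRing}
    (S : R -> X -> X) : Prop := {
  C0_linear : forall t, 0 <= t -> is_linear (S t);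
  C0_zero : forall x, S 0 x = x;
  C0_add : forall s t x, 0 <= s -> 0 <= t -> S (s + t) x = S s (S t x);
  C0_cont : forall x, filterlim (fun t => S t x) (at_right 0) (locally x)
}.

(* The equivalence fixes the domain of G as well as its values. *)
Definition is_generator {X : CompleteNormedModule R_AbsRing}
    (G : operator X) (S : R -> X -> X) : Prop :=
  forall x y : X,
    (op_dom G x /\ op_app G x = y) <->
    filterlim (fun h => scal (/ h) (minus (S h x) x)) (at_right 0) (locally y).

Definition graph_norm {X : CompleteNormedModule R_AbsRing}
    (A : operator X) (x : X) : R :=
  norm x + norm (op_app A x).

(* D is a bounded linear operator from X_1 = (dom A, graph norm) to X; it is
   represented by a function on X whose values outside dom A are ignored. *)
Record is_linear_X1 {X : CompleteNormedModule R_AbsRing}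
    (A : operator X) (D : X -> X) : Prop := {
  X1_plus : forall x y, op_dom A x -> op_dom A y ->
    D (plus x y) = plus (D x) (D y);
  X1_scal : forall (a : R) x, op_dom A x -> D (scal a x) = scal a (D x);
  X1_norm : exists M : R, 0 < M /\
    forall x, op_dom A x -> norm (D x) <= M * graph_norm A x
}.

Definition perturb {X : CompleteNormedModule R_AbsRing}
    (A : operator X) (D : X -> X) : operator X :=
  Operator (op_dom A) (fun x => plus (op_app A x) (D x)).

Definition is_solution {X U : CompleteNormedModule R_AbsRing} (tau : R)
    (S : R -> X -> X) (B0 : U -> X) (F : X -> U) (x0 : X) (x : R -> X) : Prop :=
  x 0 = x0 /\
  forall (k : nat) (t : R), 0 < t <= tau ->
    x (INR k * tau + t) =
    plus (S t (x (INR k * tau)))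
         (RInt (fun s => S s (B0 (F (x (INR k * tau))))) 0 t).

Definition exp_stable {X U : CompleteNormedModule R_AbsRing} (tau : R)
    (S : R -> X -> X) (B0 : U -> X) (F : X -> U) (omega : R) : Prop :=
  exists M omega' : R, 1 <= M /\ omega < omega' /\
    forall (x0 : X) (x : R -> X), is_solution tau S B0 F x0 x ->
      forall t, 0 <= t -> norm (x t) <= M * exp (- omega' * t) * norm x0.

(* Main.v *)
Require Import Defs.
From Stdlib Require Import Reals Lra Lia List ClassicalEpsilon ZArith.
From Coquelicot Require Import Coquelicot.

Open Scope R_scope.

(** After rescaling [T] by [exp (- lambda t)], the smallness condition on [[0, t0]]
    turns into [int_0^b |D T(s) x| ds <= 2 q |x|] for all [b], and the perturbed
    semigroup is the fixed point [S] of the contraction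
    [(V P)(t) x = int_0^t P(t - s) D T(s) x ds], [S = T + V S], defined on [dom A]
    and extended by density.  The defect [S(t + s) - S(t) S(s)] is a fixed point of
    [V] as well, hence zero; and [S - T = V S] is of order [q].  Therefore the
    one-period operator of the perturbed sampled-data system is as close as
    desired to the nominal one, and its powers inherit the exponential bound with
    an arbitrarily small loss of rate. *)

(** [q] is fixed before [D], so it may depend only on nominal data: on [lambda] and [M], which come
    from [T] and [t0], on [tau], on a bound of [B], and on the rates and the constant of the
    stability hypothesis. The stability constant of the perturbed system, on the other hand, may
    depend on [D].

    The equation [S = T + V S] lets [D] meet only orbits of [T], which stay in [dom A], and the
    smallness condition bounds exactly the integral that then occurs; where the values of the
    unknown [S] lie does not matter.

    The obstacle is the generator. [is_generator] fixes the domain, while differentiating the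
    fixed-point equation only shows that the generator of [S] extends [A + D]. Equality follows
    because, for a large real number [l], [l - (A + D)] is onto whereas [l] minus the generator of
    [S] is injective.

    The perturbed semigroup itself need not decay: [S - T] may grow like [exp (lambda * t)], and
    closeness is used only on one sampling period. *)

Section Robustness.

(** * Linear identities in a module *)

(** Syntax for a reflexive tactic: both sides of a vector identity become formal linear combinations
    of atoms, so that the identity reduces to one real equation per atom. *)
Inductive mexpr :=
  | MZero | MAtom (n : nat) | MPlus (e1 e2 : mexpr) | MOpp (e : mexpr)
  | MScal (r : R) (e : mexpr).

Section ModuleReflection.
Context {V : NormedModule R_AbsRing}.

Fixpoint mdenote (env : list V) (e : mexpr) : V :=
  match e with
  | MZero => zero
  | MAtom n => nth n env zero
  | MPlus e1 e2 => plus (mdenote env e1) (mdenote env e2)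
  | MOpp e1 => opp (mdenote env e1)
  | MScal r e1 => scal r (mdenote env e1)
  end.

Fixpoint mcoef (e : mexpr) (k : nat) : R :=
  match e with
  | MZero => 0
  | MAtom n => if Nat.eqb n k then 1 else 0
  | MPlus e1 e2 => mcoef e1 k + mcoef e2 k
  | MOpp e1 => - mcoef e1 k
  | MScal r e1 => r * mcoef e1 k
  end.

Fixpoint mcomb (env : list V) (c : nat -> R) : V :=
  match env with
  | nil => zero
  | v :: l => plus (scal (c O) v) (mcomb l (fun n => c (S n)))
  end.

(** Computes to one conjunct per atom, the shape that [repeat split] takes apart in
    [module_eq_with]. *)
Fixpoint mall (n : nat) (c c' : nat -> R) : Prop :=
  match n with
  | O => True
  | S m => c O = c' O /\ mall m (fun k => c (S k)) (fun k => c' (S k))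
  end.

Lemma mcomb_ext (env : list V) (c c' : nat -> R) :
  mall (length env) c c' -> mcomb env c = mcomb env c'.
Proof.
revert c c'; induction env as [|v l IH]; intros c c'; simpl; auto.
intros [H0 H]; rewrite H0; f_equal; auto.
Qed.

Lemma mall_eq (n : nat) (c c' : nat -> R) :
  (forall k, c k = c' k) -> mall n c c'.
Proof. revert c c'; induction n; simpl; auto. Qed.

Lemma scal_0_l (v : V) : scal (0 : R) v = zero.
Proof. exact (scal_zero_l v). Qed.

Lemma scal_1_l (v : V) : scal (1 : R) v = v.
Proof. exact (scal_one v). Qed.

Lemma mcomb_0 (env : list V) : mcomb env (fun _ => 0) = zero.
Proof.
induction env as [|v l IH]; simpl; auto.
now rewrite IH, scal_0_l, plus_zero_l.
Qed.

Lemma mcomb_plus (env : list V) (c c' : nat -> R) :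
  mcomb env (fun k => c k + c' k) = plus (mcomb env c) (mcomb env c').
Proof.
revert c c'; induction env as [|v l IH]; intros c c'; simpl.
- now rewrite plus_zero_l.
- rewrite IH.
  replace (scal (c O + c' O) v) with (plus (scal (c O) v) (scal (c' O) v))
    by (symmetry; exact (scal_distr_r (c O) (c' O) v)).
  rewrite <- !plus_assoc; f_equal.
  rewrite !plus_assoc; f_equal; apply plus_comm.
Qed.

Lemma mcomb_scal (env : list V) (r : R) (c : nat -> R) :
  mcomb env (fun k => r * c k) = scal r (mcomb env c).
Proof.
revert c; induction env as [|v l IH]; intros c; simpl.
- symmetry; exact (scal_zero_r r).
- rewrite IH.
  etransitivity; [|exact (eq_sym (scal_distr_l r _ _))].
  f_equal; symmetry; exact (scal_assoc r (c O) v).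
Qed.

Lemma mdenote_mcomb (env : list V) (e : mexpr) :
  mdenote env e = mcomb env (mcoef e).
Proof.
induction e as [|n|e1 IH1 e2 IH2|e IH|r e IH]; simpl.
- now rewrite mcomb_0.
- revert n; induction env as [|v l IH]; intros n; simpl; destruct n; auto.
  + rewrite scal_1_l; simpl.
    now rewrite mcomb_0, plus_zero_r.
  + rewrite scal_0_l, plus_zero_l; simpl; apply IH.
- now rewrite IH1, IH2, <- mcomb_plus.
- rewrite IH; etransitivity; [exact (eq_sym (scal_opp_one _))|].
  etransitivity; [exact (eq_sym (mcomb_scal env (- (1)) (mcoef e)))|].
  apply mcomb_ext, mall_eq; intros; ring.
- now rewrite IH, <- mcomb_scal.
Qed.

Lemma mdenote_eq (env : list V) (e1 e2 : mexpr) :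
  mall (length env) (mcoef e1) (mcoef e2) -> mdenote env e1 = mdenote env e2.
Proof. rewrite !mdenote_mcomb; apply mcomb_ext. Qed.

End ModuleReflection.

Ltac mindex x env :=
  lazymatch env with
  | nil => constr:(O)
  | x :: _ => constr:(O)
  | _ :: ?l => let n := mindex x l in constr:(S n)
  end.

Ltac minsert x env :=
  lazymatch env with
  | context [cons x _] => env
  | _ => let e := eval cbv [app] in (app env (cons x nil)) in e
  end.

Ltac matoms e env :=
  lazymatch e with
  | @zero _ => env
  | @plus _ ?a ?b => let env1 := matoms a env in matoms b env1
  | @minus _ ?a ?b => let env1 := matoms a env in matoms b env1
  | @opp _ ?a => matoms a env
  | @scal _ _ _ ?a => matoms a env
  | _ => minsert e env
  end.

Ltac mreify e env :=
  lazymatch e with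
  | @zero _ => constr:(MZero)
  | @plus _ ?a ?b =>
      let x := mreify a env in let y := mreify b env in constr:(MPlus x y)
  | @minus _ ?a ?b =>
      let x := mreify a env in let y := mreify b env in
      constr:(MPlus x (MOpp y))
  | @opp _ ?a => let x := mreify a env in constr:(MOpp x)
  | @scal _ _ ?r ?a => let x := mreify a env in constr:(MScal r x)
  | _ => let n := mindex e env in constr:(MAtom n)
  end.

(** The nonvanishing conditions raised by [field] stay as goals, hence the calls of the form
    [module_eq; lra] below. *)
Ltac module_eq_with V :=
  lazymatch goal with
  | |- ?a = ?b =>
      let env0 := matoms a (@nil V) in
      let env := matoms b env0 in
      let ea := mreify a env in
      let eb := mreify b env in
      change (@mdenote V env ea = @mdenote V env eb);
      apply mdenote_eq; cbv [mall length mcoef Nat.eqb];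
      repeat split; first [ring | field | idtac]
  end.

Ltac module_eq :=
  match goal with
  | X : CompleteNormedModule R_AbsRing |- @eq ?T _ _ =>
      unify T (CompleteNormedModule.sort R_AbsRing X);
      module_eq_with (CompleteNormedModule.NormedModule R_AbsRing X)
  end.

(* Coquelicot infers many convertible paths to the algebraic structure of a
   [CompleteNormedModule]; these abbreviations always take the same one, so
   that rewriting finds its redexes. *)
Local Notation plus := (@plus (NormedModule.AbelianMonoid R_AbsRing
  (CompleteNormedModule.NormedModule R_AbsRing _))) (only parsing).
Local Notation zero := (@zero (NormedModule.AbelianMonoid R_AbsRing
  (CompleteNormedModule.NormedModule R_AbsRing _))) (only parsing).
Local Notation opp := (@opp (NormedModule.AbelianGroup R_AbsRing
  (CompleteNormedModule.NormedModule R_AbsRing _))) (only parsing).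
Local Notation minus := (@minus (NormedModule.AbelianGroup R_AbsRing
  (CompleteNormedModule.NormedModule R_AbsRing _))) (only parsing).
Local Notation scal := (@scal (AbsRing.Ring R_AbsRing) (NormedModule.ModuleSpace
  R_AbsRing (CompleteNormedModule.NormedModule R_AbsRing _))) (only parsing).
Local Notation norm := (@norm R_AbsRing
  (CompleteNormedModule.NormedModule R_AbsRing _)) (only parsing).

(** * Limits and completeness in terms of the norm *)

Lemma norm_plus_le {V : CompleteNormedModule R_AbsRing} (x y : V) :
  norm (plus x y) <= norm x + norm y.
Proof. exact (norm_triangle x y). Qed.

Lemma norm_opp_eq {V : CompleteNormedModule R_AbsRing} (x : V) :
  norm (opp x) = norm x.
Proof. exact (norm_opp x). Qed.

Lemma norm_minus_sym {V : CompleteNormedModule R_AbsRing} (x y : V) :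
  norm (minus x y) = norm (minus y x).
Proof. rewrite <- (norm_opp_eq (minus x y)); f_equal; module_eq. Qed.

Lemma norm_minus_triangle {V : CompleteNormedModule R_AbsRing} (x y z : V) :
  norm (minus x z) <= norm (minus x y) + norm (minus y z).
Proof.
replace (minus x z) with (plus (minus x y) (minus y z)) by module_eq.
apply norm_plus_le.
Qed.

Lemma norm_le_minus {V : CompleteNormedModule R_AbsRing} (x y : V) :
  norm x <= norm y + norm (minus x y).
Proof.
replace (norm x) with (norm (plus y (minus x y))) by (f_equal; module_eq).
apply norm_plus_le.
Qed.

Lemma norm_minus_le {V : CompleteNormedModule R_AbsRing} (x y : V) :
  norm (minus x y) <= norm x + norm y.
Proof. unfold minus; rewrite <- (norm_opp_eq y); apply norm_plus_le. Qed.

Lemma norm_scal_le {V : CompleteNormedModule R_AbsRing} (r : R) (x : V) :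
  norm (scal r x) <= Rabs r * norm x.
Proof. exact (norm_scal r x). Qed.

Lemma norm_minus_self {V : CompleteNormedModule R_AbsRing} (x : V) :
  norm (minus x x) = 0.
Proof.
replace (minus x x) with (zero : V) by module_eq; exact norm_zero.
Qed.

Lemma norm_minus_eq {V : CompleteNormedModule R_AbsRing} (x y : V) :
  (forall eps, 0 < eps -> norm (minus x y) <= eps) -> x = y.
Proof.
intros H.
assert (E : minus x y = zero).
{ refine (norm_eq_zero _ (Rle_antisym _ _ _ (norm_ge_0 _))).
  apply Rle_plus_epsilon; intros; rewrite Rplus_0_l; auto. }
replace x with (plus (minus x y) y) by module_eq.
rewrite E; module_eq.
Qed.

Lemma filterlim_norm_iff {V : CompleteNormedModule R_AbsRing} {T : Type}
    {F : (T -> Prop) -> Prop} {FF : Filter F} (f : T -> V) (y : V) :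
  filterlim f F (locally y) <->
  forall eps, 0 < eps -> F (fun t => norm (minus (f t) y) < eps).
Proof.
split.
- intros H eps Heps.
  exact (proj1 (filterlim_locally_ball_norm f y) H (mkposreal eps Heps)).
- intros H; refine (proj2 (filterlim_locally_ball_norm f y) _).
  intros eps; apply H, cond_pos.
Qed.

Lemma filterlim_right_norm {V : CompleteNormedModule R_AbsRing} (f : R -> V) (y : V) :
  filterlim f (at_right 0) (locally y) <->
  forall eps, 0 < eps -> exists delta, 0 < delta /\
    forall h, 0 < h < delta -> norm (minus (f h) y) < eps.
Proof.
etransitivity; [exact (filterlim_norm_iff f y)|].
split; intros H eps Heps.
- destruct (H eps Heps) as [d Hd].
  exists d; split; [apply cond_pos|].
  intros h Hh; apply Hd; [|lra].
  change (Rabs (h - 0) < d); rewrite Rabs_right; lra.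
- destruct (H eps Heps) as (d & Hd & Hd').
  exists (mkposreal d Hd); intros h Hh Hpos; apply Hd'.
  change (Rabs (h - 0) < d) in Hh; rewrite Rabs_right in Hh; lra.
Qed.

Lemma continuous_norm_iff {V : CompleteNormedModule R_AbsRing} (f : R -> V) (t : R) :
  continuous f t <->
  forall eps, 0 < eps -> exists delta, 0 < delta /\
    forall s, Rabs (s - t) < delta -> norm (minus (f s) (f t)) < eps.
Proof.
etransitivity; [exact (filterlim_norm_iff (F := locally t) f (f t))|].
split; intros H eps Heps.
- destruct (H eps Heps) as [d Hd].
  exists d; split; [apply cond_pos|exact Hd].
- destruct (H eps Heps) as (d & Hd & Hd').
  exists (mkposreal d Hd); exact Hd'.
Qed.

Lemma pow_small (r c eps : R) :
  0 <= r < 1 -> 0 < eps -> exists n, c * r ^ n < eps.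
Proof.
intros Hr He.
destruct (Rle_lt_dec c 0) as [Hc|Hc].
{ exists O; simpl; lra. }
destruct (pow_lt_1_zero r) with (y := eps / c) as [N HN].
- rewrite Rabs_right; lra.
- apply Rdiv_lt_0_compat; lra.
- exists N; specialize (HN N (Nat.le_refl N)).
  rewrite Rabs_right in HN by (apply Rle_ge, pow_le; lra).
  apply Rmult_lt_compat_l with (r := c) in HN; auto.
  replace (c * (eps / c)) with eps in HN by (field; lra); lra.
Qed.

(** The common source of limits with an explicit rate: nested balls, extension by density, limits of
    operator families and the Neumann series all go through it. *)
Lemma geometric_limit {X : CompleteNormedModule R_AbsRing} (u : nat -> X)
    (c r : R) :
  0 <= r < 1 ->
  (forall n, norm (minus (u (S n)) (u n)) <= c * r ^ n) ->
  exists l, forall n, norm (minus l (u n)) <= c * r ^ n / (1 - r).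
Proof.
intros Hr Hu.
assert (Hc : 0 <= c).
{ generalize (Hu O) (norm_ge_0 (minus (u 1%nat) (u O))); simpl; lra. }
assert (Hpow : forall n, 0 <= r ^ n) by (intros; apply pow_le; lra).
assert (Hm : forall n k,
  norm (minus (u (n + k)%nat) (u n)) <= c * (r ^ n - r ^ (n + k)) / (1 - r)).
{ intros n; induction k as [|k IH].
  - rewrite Nat.add_0_r, norm_minus_self; right; field; lra.
  - rewrite Nat.add_succ_r.
    eapply Rle_trans; [apply norm_minus_triangle with (y := u (n + k)%nat)|].
    eapply Rle_trans; [apply Rplus_le_compat; [apply Hu|apply IH]|].
    right; simpl; field; lra. }
assert (Hm' : forall n m, (n <= m)%nat ->
  norm (minus (u m) (u n)) <= c * r ^ n / (1 - r)).
{ intros n m Hnm; replace m with (n + (m - n))%nat by lia.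
  eapply Rle_trans; [apply Hm|].
  apply Rmult_le_compat_r; [left; apply Rinv_0_lt_compat; lra|].
  apply Rmult_le_compat_l; [lra|].
  generalize (Hpow (n + (m - n))%nat); lra. }
destruct (proj1 (filterlim_locally_cauchy (F := eventually) (U := X) u))
  as [l Hl].
{ intros eps.
  destruct (pow_small r (c / (1 - r)) eps Hr (cond_pos eps)) as [N HN].
  exists (fun n => (N <= n)%nat); split; [exists N; auto|].
  assert (Hball : forall n m, (N <= n)%nat -> (n <= m)%nat ->
    norm (minus (u m) (u n)) < eps).
  { intros n m Hn Hnm; eapply Rle_lt_trans; [apply (Hm' _ _ Hnm)|].
    eapply Rle_lt_trans; [|apply HN].
    replace n with (N + (n - N))%nat by lia; rewrite pow_add.
    replace (c * (r ^ N * r ^ (n - N)) / (1 - r))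
      with (c / (1 - r) * r ^ N * r ^ (n - N)) by (field; lra).
    rewrite <- (Rmult_1_r (c / (1 - r) * r ^ N)) at 2.
    apply Rmult_le_compat_l.
    - apply Rmult_le_pos; [|apply Hpow].
      apply Rmult_le_pos; [lra|left; apply Rinv_0_lt_compat; lra].
    - rewrite <- (pow1 (n - N)); apply pow_incr; lra. }
  intros n m Hn Hm0; destruct (Nat.le_ge_cases n m) as [Hnm|Hnm].
  - exact (norm_compat1 (u n) (u m) eps (Hball n m Hn Hnm)).
  - refine (norm_compat1 (u n) (u m) eps _).
    eapply Rle_lt_trans; [right; exact (norm_minus_sym (u m) (u n))|].
    auto. }
exists l; intros n.
apply Rle_plus_epsilon; intros eps Heps.
destruct (proj1 (filterlim_norm_iff u l) Hl eps Heps) as [N HN].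
set (m := Nat.max N n).
eapply Rle_trans; [apply norm_minus_triangle with (y := u m)|].
rewrite norm_minus_sym.
generalize (HN m (Nat.le_max_l _ _)) (Hm' n m (Nat.le_max_r _ _)); lra.
Qed.

(** Baire category in covering form, with closedness stated as openness of the complement. If no
    [E n] contained a ball, one could choose shrinking closed balls, the ball of index [n + 1]
    missing [E n]; the limit of the centres would then lie in no [E n]. *)
Lemma baire_cover {X : CompleteNormedModule R_AbsRing} (E : nat -> X -> Prop) :
  (forall n x, ~ E n x ->
     exists r, 0 < r /\ forall y, norm (minus y x) < r -> ~ E n y) ->
  (forall x, exists n, E n x) ->
  exists n x r, 0 < r /\ forall y, norm (minus y x) < r -> E n y.
Proof.
intros Hclosed Hcover; apply NNPP; intros Hnot.
(* Positivity of the radius is a premise inside the relation, so that [choice] returns a total step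
   function. *)
assert (Hstep : forall p : nat * (X * R), exists b : X * R,
  0 < snd (snd p) ->
  0 < snd b <= snd (snd p) / 2 /\
  norm (minus (fst b) (fst (snd p))) <= snd (snd p) / 2 /\
  forall y, norm (minus y (fst b)) <= snd b -> ~ E (fst p) y).
{ intros [n [x r]]; simpl.
  destruct (Rlt_dec 0 r) as [Hr|Hr]; [|exists (x, r); intros; lra].
  destruct (classic (exists y, norm (minus y x) < r / 2 /\ ~ E n y))
    as [(y & Hy & HE)|Hno].
  - destruct (Hclosed n y HE) as (d & Hd & HdE).
    (* Half of [d] keeps the new closed ball inside the open ball that misses [E n]. *)
    exists (y, Rmin (r / 2) (d / 2)); intros _; simpl.
    split; [split; [apply Rmin_pos; lra|apply Rmin_l]|].
    split; [lra|].
    intros z Hz; apply HdE.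
    generalize (Rmin_r (r / 2) (d / 2)); lra.
  - exfalso; apply Hnot; exists n, x, (r / 2); split; [lra|].
    intros y Hy; apply NNPP; intros HE; apply Hno; exists y; auto. }
destruct (choice _ Hstep) as [step Hs].
set (b := fix b n := match n with O => (zero, 1) | S m => step (m, b m) end).
assert (Hb0 : forall n, 0 < snd (b n) <= (1 / 2) ^ n).
{ induction n as [|n IH]; simpl; [lra|].
  destruct (Hs (n, b n)) as (H1 & _); simpl in *; lra. }
assert (Hb : forall n, norm (minus (fst (b (S n))) (fst (b n)))
                       <= snd (b n) / 2 /\
  forall y, norm (minus y (fst (b (S n)))) <= snd (b (S n)) -> ~ E n y).
{ intros n; destruct (Hs (n, b n)) as (_ & H2 & H3); [apply Hb0|].
  split; auto. }
assert (Hb1 : forall n, snd (b (S n)) <= snd (b n) / 2).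
{ intros n; destruct (Hs (n, b n)) as (H1 & _); [apply Hb0|]; apply H1. }
(* The centres move at most by the amount the radii shrink, so the closed balls are nested. *)
assert (Hin : forall n k,
  norm (minus (fst (b (n + k)%nat)) (fst (b n))) <= snd (b n) - snd (b (n + k)%nat)).
{ intros n; induction k as [|k IH].
  - rewrite Nat.add_0_r, norm_minus_self; lra.
  - rewrite Nat.add_succ_r.
    eapply Rle_trans;
      [apply norm_minus_triangle with (y := fst (b (n + k)%nat))|].
    generalize (proj1 (Hb (n + k)%nat)) (Hb1 (n + k)%nat); lra. }
destruct (geometric_limit (fun n => fst (b n)) 1 (1 / 2)) as [l Hl]; [lra| |].
{ intros n; eapply Rle_trans; [apply (proj1 (Hb n))|].
  generalize (Hb0 n); lra. }
destruct (Hcover l) as [n Hn].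
apply (proj2 (Hb n) l); auto.
apply Rle_plus_epsilon; intros eps Heps.
destruct (pow_small (1 / 2) 2 eps) as [k Hk]; [lra|auto|].
eapply Rle_trans;
  [apply norm_minus_triangle with (y := fst (b (S n + k)%nat))|].
generalize (Hl (S n + k)%nat) (Hin (S n) k) (Hb0 (S n + k)%nat); intros H1 H2 H3.
assert (H4 : (1 / 2) ^ (S n + k) <= (1 / 2) ^ k).
{ rewrite pow_add; rewrite <- (Rmult_1_l ((1 / 2) ^ k)) at 2.
  apply Rmult_le_compat_r; [apply pow_le; lra|].
  apply Rle_trans with (1 ^ S n); [apply pow_incr|rewrite pow1]; lra. }
replace (1 * (1 / 2) ^ (S n + k) / (1 - 1 / 2))
  with (2 * (1 / 2) ^ (S n + k)) in H1 by field.
lra.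
Qed.

(** * Bounded linear maps *)

Lemma lin_plus {X Y : CompleteNormedModule R_AbsRing} (L : X -> Y) (x y : X) :
  is_linear L -> L (plus x y) = plus (L x) (L y).
Proof. intros HL; exact (linear_plus L HL x y). Qed.

Lemma lin_scal {X Y : CompleteNormedModule R_AbsRing} (L : X -> Y) (r : R)
    (x : X) :
  is_linear L -> L (scal r x) = scal r (L x).
Proof. intros HL; exact (linear_scal L HL r x). Qed.

Lemma lin_minus {X Y : CompleteNormedModule R_AbsRing} (L : X -> Y) (x y : X) :
  is_linear L -> L (minus x y) = minus (L x) (L y).
Proof.
intros HL; replace (minus x y) with (plus x (scal (- (1)) y)) by module_eq.
rewrite lin_plus, lin_scal by auto; module_eq.
Qed.

Lemma is_linear_intro {X Y : CompleteNormedModule R_AbsRing} (L : X -> Y)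
    (c : R) :
  (forall x y, L (plus x y) = plus (L x) (L y)) ->
  (forall (r : R) x, L (scal r x) = scal r (L x)) ->
  (forall x, norm (L x) <= c * norm x) -> is_linear L.
Proof.
intros H1 H2 H3; split; [exact H1|exact H2|].
(* [is_linear] asks for a positive bound, which [c] need not be. *)
exists (Rmax 1 c); split.
- apply Rlt_le_trans with 1; [lra|apply Rmax_l].
- intros x; eapply Rle_trans; [apply H3|].
  apply Rmult_le_compat_r; [apply norm_ge_0|apply Rmax_r].
Qed.

Lemma lin_close {X Y : CompleteNormedModule R_AbsRing} (L : X -> Y) (x : X)
    (eps : R) :
  is_linear L -> 0 < eps ->
  exists delta, 0 < delta /\
    forall y, norm (minus y x) < delta -> norm (minus (L y) (L x)) < eps.
Proof.
intros HL He; destruct (linear_norm L HL) as (M & HM & HLM).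
exists (eps / M); split; [apply Rdiv_lt_0_compat; auto|].
intros y Hy; rewrite <- lin_minus by auto.
eapply Rle_lt_trans; [apply HLM|].
apply Rmult_lt_compat_l with (r := M) in Hy; auto.
replace (M * (eps / M)) with eps in Hy by (field; lra); exact Hy.
Qed.

Definition subspace {X : CompleteNormedModule R_AbsRing} (P : X -> Prop) :=
  (forall x y, P x -> P y -> P (plus x y)) /\
  (forall (r : R) x, P x -> P (scal r x)).

Definition dense {X : CompleteNormedModule R_AbsRing} (P : X -> Prop) :=
  forall x eps, 0 < eps -> exists y, P y /\ norm (minus y x) < eps.

(** Relative linearity, for maps such as [D] and [op_app A] whose values off the domain are junk. *)
Definition linear_on {X Y : CompleteNormedModule R_AbsRing} (P : X -> Prop)
    (L : X -> Y) :=
  (forall x y, P x -> P y -> L (plus x y) = plus (L x) (L y)) /\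
  (forall (r : R) x, P x -> L (scal r x) = scal r (L x)).

Lemma subspace_minus {X : CompleteNormedModule R_AbsRing} (P : X -> Prop) x y :
  subspace P -> P x -> P y -> P (minus x y).
Proof.
intros [H1 H2] Hx Hy.
replace (minus x y) with (plus x (scal (- (1)) y)) by module_eq; auto.
Qed.

Lemma linear_on_minus {X Y : CompleteNormedModule R_AbsRing} (P : X -> Prop)
    (L : X -> Y) x y :
  subspace P -> linear_on P L -> P x -> P y ->
  L (minus x y) = minus (L x) (L y).
Proof.
intros [H1 H2] [H3 H4] Hx Hy.
replace (minus x y) with (plus x (scal (- (1)) y)) by module_eq.
rewrite H3, H4 by auto; module_eq.
Qed.

Lemma dense_norm_le {X Y : CompleteNormedModule R_AbsRing} (P : X -> Prop)
    (L : X -> Y) (c : R) :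
  dense P -> is_linear L -> 0 <= c ->
  (forall x, P x -> norm (L x) <= c * norm x) ->
  forall x, norm (L x) <= c * norm x.
Proof.
intros HP HL Hc H x; apply Rle_plus_epsilon; intros eps He.
destruct (lin_close L x (eps / 2) HL) as (d & Hd & HLd); [lra|].
(* Dividing by [c + 1] covers [c = 0]; the same device recurs below. *)
destruct (HP x (Rmin d (eps / (2 * (c + 1))))) as (y & Hy & Hyx).
{ apply Rmin_pos; auto; apply Rdiv_lt_0_compat; lra. }
assert (H1 : norm (minus (L y) (L x)) < eps / 2).
{ apply HLd; eapply Rlt_le_trans; [apply Hyx|apply Rmin_l]. }
assert (H2 : norm (minus y x) < eps / (2 * (c + 1))).
{ eapply Rlt_le_trans; [apply Hyx|apply Rmin_r]. }
assert (H3 : c * norm (minus y x) <= eps / 2).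
{ apply Rle_trans with ((c + 1) * (eps / (2 * (c + 1)))).
  - apply Rmult_le_compat; auto using norm_ge_0; lra.
  - right; field; lra. }
generalize (norm_le_minus (L x) (L y)) (H y Hy) (norm_le_minus y x).
rewrite (norm_minus_sym (L x) (L y)); intros H4 H5 H6.
apply Rmult_le_compat_l with (r := c) in H6; auto; lra.
Qed.

Lemma dense_linear_eq {X Y : CompleteNormedModule R_AbsRing} (P : X -> Prop)
    (L1 L2 : X -> Y) :
  dense P -> is_linear L1 -> is_linear L2 ->
  (forall x, P x -> L1 x = L2 x) -> forall x, L1 x = L2 x.
Proof.
intros HP H1 H2 H x; apply norm_minus_eq; intros eps He.
destruct (lin_close L1 x (eps / 2) H1) as (d1 & Hd1 & HL1); [lra|].
destruct (lin_close L2 x (eps / 2) H2) as (d2 & Hd2 & HL2); [lra|].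
destruct (HP x (Rmin d1 d2)) as (y & Hy & Hyx); [apply Rmin_pos; auto|].
assert (Hy1 : norm (minus y x) < d1)
  by (eapply Rlt_le_trans; [apply Hyx|apply Rmin_l]).
assert (Hy2 : norm (minus y x) < d2)
  by (eapply Rlt_le_trans; [apply Hyx|apply Rmin_r]).
apply HL1 in Hy1; apply HL2 in Hy2; rewrite (H y Hy) in Hy1.
eapply Rle_trans; [apply norm_minus_triangle with (y := L2 y)|].
rewrite norm_minus_sym; lra.
Qed.

(* The extension at [x] is the unique [z] with [norm (z - L y) <= c norm (x - y)]
   for all [y] in the dense subspace. *)
Lemma dense_extension {X Y : CompleteNormedModule R_AbsRing} (P : X -> Prop)
    (L : X -> Y) (c : R) :
  subspace P -> dense P -> linear_on P L -> 0 <= c ->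
  (forall x, P x -> norm (L x) <= c * norm x) ->
  exists L' : X -> Y, is_linear L' /\
    (forall x, norm (L' x) <= c * norm x) /\ (forall x, P x -> L' x = L x).
Proof.
intros HP HD HL Hc Hb.
assert (Hb2 : forall x y : X, P x -> P y ->
  norm (minus (L x) (L y)) <= c * norm (minus x y)).
{ intros x y Hx Hy; rewrite <- (linear_on_minus P) by auto.
  apply Hb, subspace_minus; auto. }
assert (Hex : forall x : X, exists z : Y,
  forall y, P y -> norm (minus z (L y)) <= c * norm (minus x y)).
{ intros x.
  assert (Hseq : forall n, exists y, P y /\ norm (minus y x) < (1 / 2) ^ n).
  { intros n; apply HD, pow_lt; lra. }
  destruct (choice _ Hseq) as [u Hu].
  destruct (geometric_limit (fun n => L (u n)) (2 * c) (1 / 2)) as [z Hz];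
    [lra| |].
  - intros n; eapply Rle_trans; [apply Hb2; apply Hu|].
    rewrite (Rmult_comm 2), Rmult_assoc; apply Rmult_le_compat_l; auto.
    generalize (norm_minus_triangle (u (S n)) x (u n)) (proj2 (Hu n))
      (proj2 (Hu (S n))); rewrite (norm_minus_sym x); simpl.
    generalize (pow_le (1 / 2) n); lra.
  - exists z; intros y Hy; apply Rle_plus_epsilon; intros eps He.
    (* The tail of the sequence contributes [4 * c], and the distance from [u n] to [x] one more
       [c]. *)
    destruct (pow_small (1 / 2) (5 * c) eps) as [n Hn]; [lra|auto|].
    eapply Rle_trans; [apply norm_minus_triangle with (y := L (u n))|].
    generalize (Hz n) (Hb2 (u n) y (proj1 (Hu n)) Hy).
    replace (2 * c * (1 / 2) ^ n / (1 - 1 / 2)) with (4 * c * (1 / 2) ^ n)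
      by field.
    assert (H : c * norm (minus (u n) y)
                <= c * ((1 / 2) ^ n + norm (minus x y))).
    { apply Rmult_le_compat_l; auto.
      generalize (norm_minus_triangle (u n) x y) (proj2 (Hu n)); lra. }
    lra. }
destruct (choice _ Hex) as [L' HL'].
assert (Happrox : forall (x y : X) eps, 0 < eps -> exists a b : X,
  P a /\ P b /\ c * norm (minus x a) <= eps /\ c * norm (minus y b) <= eps).
{ intros x y eps He.
  assert (H1 : forall x : X, exists a : X, P a /\ c * norm (minus x a) <= eps).
  { intros w; destruct (HD w (eps / (c + 1))) as (a & Ha & Haw).
    - apply Rdiv_lt_0_compat; lra.
    - exists a; split; auto; rewrite norm_minus_sym.
      apply Rle_trans with ((c + 1) * (eps / (c + 1))).
      + apply Rmult_le_compat; auto using norm_ge_0; lra.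
      + right; field; lra. }
  destruct (H1 x) as (a & Ha & Hxa); destruct (H1 y) as (b & Hb' & Hyb).
  exists a, b; auto. }
assert (Hplus : forall x y : X, L' (plus x y) = plus (L' x) (L' y)).
{ intros x y; apply norm_minus_eq; intros eps He.
  destruct (Happrox x y (eps / 4)) as (a & b & Ha & Hb' & Hxa & Hyb); [lra|].
  eapply Rle_trans;
    [apply norm_minus_triangle with (y := L (plus a b))|].
  assert (H1 : norm (minus (L' (plus x y)) (L (plus a b))) <= eps / 2).
  { eapply Rle_trans; [apply HL', HP; auto|].
    replace (minus (plus x y) (plus a b))
      with (plus (minus x a) (minus y b)) by module_eq.
    eapply Rle_trans; [apply Rmult_le_compat_l; [auto|apply norm_plus_le]|].
    lra. }
  assert (H2 : norm (minus (L (plus a b)) (plus (L' x) (L' y))) <= eps / 2).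
  { rewrite (proj1 HL) by auto; rewrite norm_minus_sym.
    replace (minus (plus (L' x) (L' y)) (plus (L a) (L b)))
      with (plus (minus (L' x) (L a)) (minus (L' y) (L b))) by module_eq.
    eapply Rle_trans; [apply norm_plus_le|].
    generalize (HL' x a Ha) (HL' y b Hb'); lra. }
  lra. }
assert (Hscal : forall (r : R) (x : X), L' (scal r x) = scal r (L' x)).
{ intros r x; apply norm_minus_eq; intros eps He.
  destruct (Happrox x x (eps / (2 * (Rabs r + 1)))) as (a & _ & Ha & _ & Hxa & _).
  { apply Rdiv_lt_0_compat; generalize (Rabs_pos r); lra. }
  assert (Hr : Rabs r * (eps / (2 * (Rabs r + 1))) <= eps / 2).
  { apply Rle_trans with ((Rabs r + 1) * (eps / (2 * (Rabs r + 1)))).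
    - apply Rmult_le_compat_r; [|lra].
      left; apply Rdiv_lt_0_compat; generalize (Rabs_pos r); lra.
    - right; field; generalize (Rabs_pos r); lra. }
  apply Rmult_le_compat_l with (r := Rabs r) in Hxa; [|apply Rabs_pos].
  eapply Rle_trans;
    [apply norm_minus_triangle with (y := L (scal r a))|].
  assert (H1 : norm (minus (L' (scal r x)) (L (scal r a))) <= eps / 2).
  { eapply Rle_trans; [apply HL', HP; auto|].
    replace (minus (scal r x) (scal r a))
      with (scal r (minus x a)) by module_eq.
    eapply Rle_trans; [apply Rmult_le_compat_l; [auto|apply norm_scal_le]|].
    lra. }
  assert (H2 : norm (minus (L (scal r a)) (scal r (L' x))) <= eps / 2).
  { rewrite (proj2 HL) by auto; rewrite norm_minus_sym.
    replace (minus (scal r (L' x)) (scal r (L a)))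
      with (scal r (minus (L' x) (L a))) by module_eq.
    eapply Rle_trans; [apply norm_scal_le|].
    apply Rle_trans with (Rabs r * (c * norm (minus x a))); [|lra].
    apply Rmult_le_compat_l; [apply Rabs_pos|auto]. }
  lra. }
assert (Hext : forall x : X, P x -> L' x = L x).
{ intros x Hx; apply norm_minus_eq; intros eps He.
  eapply Rle_trans; [apply (HL' x x Hx)|].
  rewrite norm_minus_self; lra. }
assert (Hlin : forall x : X, norm (L' x) <= c * norm x).
{ intros x; apply Rle_plus_epsilon; intros eps He.
  destruct (Happrox x x (eps / 2)) as (a & _ & Ha & _ & Hxa & _); [lra|].
  generalize (norm_le_minus (L' x) (L a)) (HL' x a Ha) (Hb a Ha)
    (norm_le_minus a x); rewrite (norm_minus_sym a); intros H1 H2 H3 H4.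
  apply Rmult_le_compat_l with (r := c) in H4; auto; lra. }
exists L'; split; [|split]; auto.
apply (is_linear_intro L' c); auto.
Qed.

(** * Integrals of continuous functions *)

Lemma ex_RInt_cont {X : CompleteNormedModule R_AbsRing} (f : R -> X) a b :
  (forall t, continuous f t) -> ex_RInt f a b.
Proof. intros H; apply ex_RInt_continuous; auto. Qed.

Lemma is_RInt_cont {X : CompleteNormedModule R_AbsRing} (f : R -> X) a b :
  (forall t, continuous f t) -> is_RInt f a b (RInt f a b).
Proof. intros H; apply RInt_correct, ex_RInt_cont; auto. Qed.

Lemma continuous_norm_comp {X : CompleteNormedModule R_AbsRing} (f : R -> X) t :
  continuous f t -> continuous (fun s => norm (f s)) t.
Proof.
intros H; apply (continuous_comp f (fun x : X => norm x)); auto.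
exact (filterlim_norm (f t)).
Qed.

Lemma RInt_norm_le {X : CompleteNormedModule R_AbsRing} (f : R -> X)
    (g : R -> R) a b :
  a <= b -> (forall t, continuous f t) -> (forall t, continuous g t) ->
  (forall t, a <= t <= b -> norm (f t) <= g t) ->
  norm (RInt f a b) <= RInt g a b.
Proof.
intros Hab Hf Hg H.
exact (norm_RInt_le f g a b _ _ Hab H (is_RInt_cont f a b Hf)
  (is_RInt_cont (X := R_CompleteNormedModule) g a b Hg)).
Qed.

Lemma RInt_norm_le_const {X : CompleteNormedModule R_AbsRing} (f : R -> X)
    a b c :
  a <= b -> (forall t, continuous f t) ->
  (forall t, a <= t <= b -> norm (f t) <= c) ->
  norm (RInt f a b) <= (b - a) * c.
Proof.
intros Hab Hf H.
exact (norm_RInt_le_const f a b _ c Hab H (is_RInt_cont f a b Hf)).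
Qed.

Lemma RInt_minus_cont {X : CompleteNormedModule R_AbsRing} (f g : R -> X) a b :
  (forall t, continuous f t) -> (forall t, continuous g t) ->
  RInt (fun t => minus (f t) (g t)) a b = minus (RInt f a b) (RInt g a b).
Proof.
intros Hf Hg.
exact (RInt_minus f g a b (ex_RInt_cont f a b Hf) (ex_RInt_cont g a b Hg)).
Qed.

Lemma RInt_plus_cont {X : CompleteNormedModule R_AbsRing} (f g : R -> X) a b :
  (forall t, continuous f t) -> (forall t, continuous g t) ->
  RInt (fun t => plus (f t) (g t)) a b = plus (RInt f a b) (RInt g a b).
Proof.
intros Hf Hg.
exact (RInt_plus f g a b (ex_RInt_cont f a b Hf) (ex_RInt_cont g a b Hg)).
Qed.

Lemma RInt_scal_cont {X : CompleteNormedModule R_AbsRing} (f : R -> X) a b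
    (r : R) :
  (forall t, continuous f t) ->
  RInt (fun t => scal r (f t)) a b = scal r (RInt f a b).
Proof. intros Hf; exact (RInt_scal f a b r (ex_RInt_cont f a b Hf)). Qed.

Lemma RInt_Chasles_cont {X : CompleteNormedModule R_AbsRing} (f : R -> X) a b c :
  (forall t, continuous f t) ->
  RInt f a c = plus (RInt f a b) (RInt f b c).
Proof.
intros Hf; symmetry.
exact (RInt_Chasles f a b c (ex_RInt_cont f a b Hf) (ex_RInt_cont f b c Hf)).
Qed.

Lemma RInt_point_0 {X : CompleteNormedModule R_AbsRing} (f : R -> X) a :
  RInt f a a = zero.
Proof. exact (RInt_point a f). Qed.

Lemma RInt_shift {X : CompleteNormedModule R_AbsRing} (f : R -> X) a b c :
  (forall t, continuous f t) ->
  RInt (fun s => f (s + c)) a b = RInt f (a + c) (b + c).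
Proof.
intros Hf; apply is_RInt_unique.
apply (is_RInt_ext (fun y => scal 1 (f (1 * y + c)))).
- intros t _; rewrite Rmult_1_l; module_eq.
- apply is_RInt_comp_lin; rewrite !Rmult_1_l; apply is_RInt_cont; auto.
Qed.

(** Moves the variable endpoint into the integrand. Continuity in [t] becomes that of a parameter
    integral over a fixed interval, and the extracted factor [t] gives the derivative at 0. *)
Lemma RInt_to_unit {X : CompleteNormedModule R_AbsRing} (f : R -> X) t :
  (forall t, continuous f t) ->
  RInt f 0 t = scal t (RInt (fun s => f (t * s)) 0 1).
Proof.
intros Hf.
assert (Hc : forall s, continuous (fun s => f (t * s)) s).
{ intros s; apply (continuous_comp (fun s => t * s) f); auto.
  apply (continuous_scal_r t (fun s : R => s)), continuous_id. }
rewrite <- RInt_scal_cont by auto.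
symmetry; apply is_RInt_unique.
apply (is_RInt_ext (fun y => scal t (f (t * y + 0)))).
- intros s _; rewrite Rplus_0_r; auto.
- apply is_RInt_comp_lin.
  replace (t * 0 + 0) with 0 by ring; replace (t * 1 + 0) with t by ring.
  apply is_RInt_cont; auto.
Qed.

(** A Heine-Borel argument: the radii of joint continuity at the points [(t, s)] form a gauge on
    [[a, b]], to which compactness gives a common lower bound. *)
Lemma continuous_unif {X : CompleteNormedModule R_AbsRing} (h : R -> R -> X)
    (a b t eps : R) :
  (forall s eps, 0 < eps -> exists delta, 0 < delta /\
    forall t' s', Rabs (t' - t) < delta -> Rabs (s' - s) < delta ->
    norm (minus (h t' s') (h t s)) < eps) ->
  0 < eps -> exists delta, 0 < delta /\
    forall t' s, Rabs (t' - t) < delta -> a <= s <= b ->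
    norm (minus (h t' s) (h t s)) < eps.
Proof.
intros H He.
assert (Hd : forall s, exists delta : posreal,
  forall t' s', Rabs (t' - t) < delta -> Rabs (s' - s) < delta ->
    norm (minus (h t' s') (h t s)) < eps / 2).
{ intros s; destruct (H s (eps / 2)) as (d & Hd & Hd'); [lra|].
  exists (mkposreal d Hd); exact Hd'. }
destruct (choice _ Hd) as [delta Hdelta].
destruct (compactness_value_1d a b delta) as [d Hd'].
exists d; split; [apply cond_pos|].
(* [compactness_value_1d] yields the nearby point [r] only under a double negation. *)
intros t' s Ht Hs; apply NNPP; intros Hn; apply (Hd' s Hs).
intros (r & _ & Hr & Hdr); apply Hn.
eapply Rle_lt_trans; [apply norm_minus_triangle with (y := h t r)|].
assert (H1 : norm (minus (h t' s) (h t r)) < eps / 2)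
  by (apply Hdelta; lra).
assert (H2 : norm (minus (h t s) (h t r)) < eps / 2).
{ apply Hdelta; [|lra].
  rewrite Rminus_diag, Rabs_R0; apply cond_pos. }
rewrite norm_minus_sym in H2; lra.
Qed.

Lemma continuous_RInt_param {X : CompleteNormedModule R_AbsRing}
    (h : R -> R -> X) (a b t : R) :
  a <= b ->
  (forall t s eps, 0 < eps -> exists delta, 0 < delta /\
    forall t' s', Rabs (t' - t) < delta -> Rabs (s' - s) < delta ->
    norm (minus (h t' s') (h t s)) < eps) ->
  continuous (fun t => RInt (h t) a b) t.
Proof.
intros Hab H; apply continuous_norm_iff; intros eps He.
assert (Hc : forall t s, continuous (h t) s).
{ intros r s; apply continuous_norm_iff; intros e Hpos.
  destruct (H r s e Hpos) as (d & Hd & Hd'); exists d; split; auto.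
  intros s' Hs; apply Hd'; auto; rewrite Rminus_diag, Rabs_R0; auto. }
assert (He' : 0 < eps / (b - a + 1)) by (apply Rdiv_lt_0_compat; lra).
destruct (continuous_unif h a b t _ (H t) He') as (d & Hd & Hd').
exists d; split; auto; intros t' Ht.
rewrite <- RInt_minus_cont by auto.
apply Rle_lt_trans with ((b - a) * (eps / (b - a + 1))).
- apply RInt_norm_le_const; auto.
  + intros s; apply (continuous_minus (h t') (h t)); auto.
  + intros s Hs; left; auto.
- apply Rlt_le_trans with ((b - a + 1) * (eps / (b - a + 1))).
  + apply Rmult_lt_compat_r; lra.
  + right; field; lra.
Qed.

(** * Integrals and linear maps *)

Lemma Riemann_sum_linear_on {X Y : CompleteNormedModule R_AbsRing}
    (P : X -> Prop) (L : X -> Y) (f : R -> X) (ptd : SF_seq) :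
  subspace P -> linear_on P L -> (forall s, P (f s)) ->
  P (Riemann_sum f ptd) /\
  L (Riemann_sum f ptd) = Riemann_sum (fun s => L (f s)) ptd.
Proof.
intros [HP1 HP2] [HL1 HL2] Hf.
induction ptd as [x|p ptd [IH1 IH2]] using SF_cons_ind.
- change (P zero /\ L zero = zero).
  replace (zero : X) with (scal 0 (f 0)) by module_eq.
  split; auto.
  rewrite HL2 by auto; module_eq.
- rewrite !Riemann_sum_cons; split; [apply HP1; auto; apply HP2; auto|].
  etransitivity; [apply HL1; auto; apply HP2; auto|].
  rewrite IH2; f_equal; apply HL2; auto.
Qed.

(* [L] is only assumed bounded for the graph norm of [A], so [A] must commute
   with the integral as well. *)
Lemma is_RInt_graph_bounded {X Y Z : CompleteNormedModule R_AbsRing}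
    (P : X -> Prop) (A : X -> Z) (L : X -> Y) (f : R -> X) a b (I : X) (M : R) :
  subspace P -> linear_on P A -> linear_on P L -> 0 < M ->
  (forall x, P x -> norm (L x) <= M * (norm x + norm (A x))) ->
  (forall s, P (f s)) -> P I ->
  is_RInt f a b I -> is_RInt (fun s => A (f s)) a b (A I) ->
  is_RInt (fun s => L (f s)) a b (L I).
Proof.
intros HP HA HL HM Hb Hf HI Hi HAi.
unfold is_RInt in *.
apply (filterlim_norm_iff (F := Riemann_fine a b)); intros eps He.
assert (He' : 0 < eps / (2 * M)) by (apply Rdiv_lt_0_compat; lra).
generalize (filter_and _ _
  (proj1 (filterlim_norm_iff (F := Riemann_fine a b) _ _) Hi _ He')
  (proj1 (filterlim_norm_iff (F := Riemann_fine a b) _ _) HAi _ He')).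
apply filter_imp; intros ptd [H1 H2].
destruct (Riemann_sum_linear_on P L f ptd HP HL Hf) as [H3 H4].
(* The Riemann sums stay in [P], so the graph-norm bound applies to the difference between such a
   sum and [I]. *)
destruct (Riemann_sum_linear_on P A f ptd HP HA Hf) as [_ H5].
set (k := sign (b - a)) in *.
change (norm (minus (scal k (Riemann_sum (fun s => L (f s)) ptd)) (L I)) < eps).
change (norm (minus (scal k (Riemann_sum (fun s => A (f s)) ptd)) (A I))
        < eps / (2 * M)) in H2.
change (norm (minus (scal k (Riemann_sum f ptd)) I) < eps / (2 * M)) in H1.
rewrite <- H4; rewrite <- H5 in H2; clear H4 H5.
set (S := Riemann_sum f ptd) in *.
assert (H6 : P (scal k S)) by (apply HP; auto).
rewrite <- (proj2 HL) by auto; rewrite <- (proj2 HA) in H2 by auto.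
rewrite <- (linear_on_minus P) by auto.
rewrite <- (linear_on_minus P A) in H2 by auto.
eapply Rle_lt_trans; [apply Hb, subspace_minus; auto|].
replace eps with (M * (eps / (2 * M) + eps / (2 * M))) by (field; lra).
apply Rmult_lt_compat_l; lra.
Qed.

Lemma RInt_linear {X Y : CompleteNormedModule R_AbsRing} (L : X -> Y)
    (f : R -> X) a b :
  is_linear L -> (forall t, continuous f t) ->
  RInt (fun s => L (f s)) a b = L (RInt f a b).
Proof.
intros HL Hf; destruct (linear_norm L HL) as (M & HM & Hb).
apply is_RInt_unique.
(* With the zero operator in place of [A], the graph norm is the norm itself. *)
apply (is_RInt_graph_bounded (Z := Y) (fun _ => True) (fun _ => zero) L f a b _ M);
  auto.
- split; auto.
- split; intros; module_eq.
- split; intros; [apply lin_plus|apply lin_scal]; auto.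
- intros x _; rewrite Rmult_plus_distr_l.
  assert (E : norm (zero : Y) = 0) by exact norm_zero.
  rewrite E; generalize (Hb x); simpl; lra.
- apply is_RInt_cont; auto.
- assert (E : scal (b - a) (zero : Y) = zero) by module_eq.
  exact (eq_ind _ (is_RInt (fun _ => zero : Y) a b)
    (is_RInt_const a b (zero : Y)) _ E).
Qed.

(** * Strongly continuous semigroups and their generators *)

(** Semigroups are constrained only at nonnegative times. Freezing the value at 0 gives functions
    continuous on the whole line, as the integral lemmas require. *)
Definition clamp {A : Type} (P : R -> A) (t : R) : A := P (Rmax 0 t).

Lemma clamp_pos {A : Type} (P : R -> A) t : 0 <= t -> clamp P t = P t.
Proof. intros Ht; unfold clamp; now rewrite Rmax_right. Qed.

Definition generates {X : CompleteNormedModule R_AbsRing} (T : R -> X -> X)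
    (x y : X) : Prop :=
  filterlim (fun h => scal (/ h) (minus (T h x) x)) (at_right 0) (locally y).

Lemma generates_iff {X : CompleteNormedModule R_AbsRing} (T : R -> X -> X)
    (x y : X) :
  generates T x y <->
  forall eps, 0 < eps -> exists delta, 0 < delta /\
    forall h, 0 < h < delta ->
    norm (minus (scal (/ h) (minus (T h x) x)) y) < eps.
Proof. apply filterlim_right_norm. Qed.

Lemma C0_right_cont {X : CompleteNormedModule R_AbsRing} (T : R -> X -> X) x eps :
  C0_semigroup T -> 0 < eps ->
  exists delta, 0 < delta /\
    forall h, 0 <= h < delta -> norm (minus (T h x) x) < eps.
Proof.
intros HT He.
destruct (proj1 (filterlim_right_norm _ _) (C0_cont _ HT x) eps He)
  as (d & Hd & Hd').
exists d; split; auto; intros h Hh.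
destruct (Req_dec h 0) as [->|Hh0]; [|apply Hd'; lra].
rewrite (C0_zero _ HT), norm_minus_self; auto.
Qed.

(** Rescaling [x] to norm [r / 2] costs the factor [2 / r]; a vector of norm zero is handled by the
    boundedness of [L]. *)
Lemma linear_ball_bound {X Y : CompleteNormedModule R_AbsRing} (L : X -> Y)
    (r c : R) :
  is_linear L -> 0 < r -> (forall x, norm x < r -> norm (L x) <= c) ->
  forall x, norm (L x) <= 2 * c / r * norm x.
Proof.
intros HL Hr H x.
destruct (Req_dec (norm x) 0) as [E|E].
- destruct (linear_norm L HL) as (M & HM & Hb).
  specialize (Hb x); change (norm (L x) <= M * norm x) in Hb.
  rewrite E in *; lra.
- assert (Hx : 0 < norm x) by (generalize (norm_ge_0 x); intros; lra).
  assert (Hk : 0 < r / (2 * norm x)) by (apply Rdiv_lt_0_compat; lra).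
  assert (H1 : norm (L (scal (r / (2 * norm x)) x)) <= c).
  { apply H; eapply Rle_lt_trans; [apply norm_scal_le|].
    rewrite Rabs_right by lra.
    replace (r / (2 * norm x) * norm x) with (r / 2) by (field; lra); lra. }
  replace (L x) with
    (scal (2 * norm x / r) (L (scal (r / (2 * norm x)) x))).
  + eapply Rle_trans; [apply norm_scal_le|].
    rewrite Rabs_right by (left; apply Rdiv_lt_0_compat; lra).
    replace (2 * c / r * norm x) with (2 * norm x / r * c) by (field; lra).
    apply Rmult_le_compat_l; auto; left; apply Rdiv_lt_0_compat; lra.
  + rewrite lin_scal by auto; module_eq; split; lra.
Qed.

(** Strong continuity bounds each orbit near 0, with a bound and an interval depending on the
    vector; Baire makes both uniform. The index [n] serves at once as the bound and, through
    [/ (INR n + 1)], as the length of the interval, so that a countable cover suffices. *)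
Lemma C0_bounded_near_0 {X : CompleteNormedModule R_AbsRing} (T : R -> X -> X) :
  C0_semigroup T ->
  exists delta c, 0 < delta /\ 1 <= c /\
    forall t x, 0 <= t <= delta -> norm (T t x) <= c * norm x.
Proof.
intros HT.
destruct (baire_cover (fun n x =>
    forall t, 0 <= t <= / (INR n + 1) -> norm (T t x) <= INR n))
  as (n & x0 & r & Hr & Hball).
- intros n x Hn.
  apply not_all_ex_not in Hn; destruct Hn as [t Hn].
  apply imply_to_and in Hn; destruct Hn as [Ht Hn].
  apply Rnot_le_lt in Hn.
  destruct (lin_close (T t) x (norm (T t x) - INR n)) as (d & Hd & Hd').
  { apply (C0_linear _ HT); lra. }
  { lra. }
  exists d; split; auto; intros y Hy HE; specialize (Hd' y Hy).
  generalize (HE t Ht) (norm_le_minus (T t x) (T t y)).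
  rewrite (norm_minus_sym (T t x)); lra.
- intros x; destruct (C0_right_cont T x 1 HT) as (d & Hd & Hd'); [lra|].
  destruct (INR_unbounded (norm x + 1 + / d)) as [n Hn].
  exists n; intros t Ht.
  assert (Hpos : 0 < / d) by (apply Rinv_0_lt_compat; lra).
  assert (Hx := norm_ge_0 x).
  assert (H1 : norm (minus (T t x) x) < 1).
  { apply Hd'; split; [lra|].
    apply Rle_lt_trans with (/ (INR n + 1)); [lra|].
    rewrite <- (Rinv_inv d); apply Rinv_lt_contravar.
    - apply Rmult_lt_0_compat; lra.
    - lra. }
  generalize (norm_le_minus (T t x) x); lra.
- assert (Hn1 : 0 < INR n + 1) by (generalize (pos_INR n); lra).
  exists (/ (INR n + 1)), (Rmax 1 (2 * (2 * INR n) / r)).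
  split; [apply Rinv_0_lt_compat; auto|split; [apply Rmax_l|]].
  intros t x Ht.
  apply Rle_trans with (2 * (2 * INR n) / r * norm x);
    [|apply Rmult_le_compat_r; [apply norm_ge_0|apply Rmax_r]].
  assert (HL : is_linear (T t)) by (apply (C0_linear _ HT); lra).
  apply linear_ball_bound; auto.
  intros y Hy.
  (* A small vector is a difference of two points of the ball, and both orbits are bounded by
     [INR n]. *)
  replace y with (minus (plus x0 y) x0) by module_eq.
  rewrite lin_minus by auto.
  eapply Rle_trans; [apply norm_minus_le|].
  assert (H1 : norm (T t (plus x0 y)) <= INR n).
  { apply Hball; auto.
    replace (minus (plus x0 y) x0) with y by module_eq; auto. }
  assert (H2 : norm (T t x0) <= INR n).
  { apply Hball; auto; rewrite norm_minus_self; auto. }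
  lra.
Qed.

Lemma C0_bounded {X : CompleteNormedModule R_AbsRing} (T : R -> X -> X) (b : R) :
  C0_semigroup T ->
  exists c, 1 <= c /\ forall t x, 0 <= t <= b -> norm (T t x) <= c * norm x.
Proof.
intros HT; destruct (C0_bounded_near_0 T HT) as (d & c & Hd & Hc & H).
assert (Hn : forall n t x, 0 <= t <= INR n * d ->
  norm (T t x) <= c ^ n * norm x).
{ induction n as [|n IH]; intros t x Ht.
  - simpl in *; replace t with 0 by lra; rewrite (C0_zero _ HT); lra.
  - rewrite S_INR in Ht.
    assert (Hpow : 1 <= c ^ n) by (apply pow_R1_Rle; auto).
    destruct (Rle_dec t d) as [Htd|Htd].
    + eapply Rle_trans; [apply H; lra|].
      apply Rmult_le_compat_r; [apply norm_ge_0|simpl].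
      rewrite <- (Rmult_1_r c) at 1; apply Rmult_le_compat_l; lra.
    + replace t with (d + (t - d)) by ring.
      rewrite (C0_add _ HT) by lra.
      eapply Rle_trans; [apply H; lra|]; simpl; rewrite Rmult_assoc.
      apply Rmult_le_compat_l; [lra|apply IH; lra]. }
destruct (INR_unbounded (b / d)) as [n Hb].
exists (c ^ n); split; [apply pow_R1_Rle; auto|].
intros t x Ht; apply Hn; split; [lra|].
apply Rle_trans with (b / d * d).
- replace (b / d * d) with b by (field; lra); lra.
- apply Rmult_le_compat_r; lra.
Qed.

(** Only right continuity at 0 is given. For [a <= b], [T b x - T a x = T a (T (b - a) x - x)], and
    the local bound on [T a] then yields continuity from both sides. *)
Lemma C0_clamp_cont {X : CompleteNormedModule R_AbsRing} (T : R -> X -> X) x t :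
  C0_semigroup T -> continuous (fun s => clamp T s x) t.
Proof.
intros HT; apply continuous_norm_iff; intros eps He.
destruct (C0_bounded T (Rabs t + 1) HT) as (c & Hc & Hb).
destruct (C0_right_cont T x (eps / c) HT) as (d & Hd & Hd').
{ apply Rdiv_lt_0_compat; lra. }
assert (Hle : forall a b, 0 <= a <= b -> a <= Rabs t + 1 -> b - a < d ->
  norm (minus (T b x) (T a x)) < eps).
{ intros a b Hab Ha Hlt.
  replace b with (a + (b - a)) by ring.
  rewrite (C0_add _ HT) by lra.
  rewrite <- lin_minus by (apply (C0_linear _ HT); lra).
  eapply Rle_lt_trans; [apply Hb; lra|].
  replace eps with (c * (eps / c)) by (field; lra).
  apply Rmult_lt_compat_l; [lra|apply Hd'; lra]. }
exists (Rmin 1 d); split; [apply Rmin_pos; lra|].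
intros s Hs.
assert (H1 : Rabs (s - t) < 1) by (eapply Rlt_le_trans; [apply Hs|apply Rmin_l]).
assert (H2 : Rabs (s - t) < d) by (eapply Rlt_le_trans; [apply Hs|apply Rmin_r]).
apply Rabs_def2 in H1; apply Rabs_def2 in H2.
generalize (Rle_abs t) (Rabs_pos t); intros H3 H4.
unfold clamp; destruct (Rle_dec (Rmax 0 s) (Rmax 0 t)) as [Hst|Hst];
  [rewrite norm_minus_sym|apply Rnot_le_lt in Hst];
  (apply Hle; [split; [apply Rmax_l|lra]| |]);
  unfold Rmax in *; destruct (Rle_dec 0 s), (Rle_dec 0 t); lra.
Qed.

Lemma generates_unique {X : CompleteNormedModule R_AbsRing} (T : R -> X -> X)
    (x y y' : X) :
  generates T x y -> generates T x y' -> y = y'.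
Proof.
intros H H'; exact (filterlim_locally_unique _ y y' H H').
Qed.

Lemma generates_plus {X : CompleteNormedModule R_AbsRing} (T : R -> X -> X)
    (x y x' y' : X) :
  C0_semigroup T -> generates T x y -> generates T x' y' ->
  generates T (plus x x') (plus y y').
Proof.
intros HT H H'; apply generates_iff; intros eps He.
destruct (proj1 (generates_iff _ _ _) H (eps / 2)) as (d & Hd & Hd'); [lra|].
destruct (proj1 (generates_iff _ _ _) H' (eps / 2)) as (e & Hpos & He'); [lra|].
exists (Rmin d e); split; [apply Rmin_pos; auto|].
intros h Hh.
generalize (Rmin_l d e) (Rmin_r d e) (Hd' h) (He' h); intros.
rewrite (lin_plus (T h)) by (apply (C0_linear _ HT); lra).
replace (minus (scal (/ h) (minus (plus (T h x) (T h x')) (plus x x'))) (plus y y'))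
  with (plus (minus (scal (/ h) (minus (T h x) x)) y)
             (minus (scal (/ h) (minus (T h x') x')) y')) by (module_eq; lra).
eapply Rle_lt_trans; [apply norm_plus_le|lra].
Qed.

Lemma generates_scal {X : CompleteNormedModule R_AbsRing} (T : R -> X -> X)
    (r : R) (x y : X) :
  C0_semigroup T -> generates T x y -> generates T (scal r x) (scal r y).
Proof.
intros HT H; apply generates_iff; intros eps He.
assert (Hr := Rabs_pos r).
destruct (proj1 (generates_iff _ _ _) H (eps / (Rabs r + 1))) as (d & Hd & Hd').
{ apply Rdiv_lt_0_compat; lra. }
exists d; split; auto; intros h Hh.
rewrite (lin_scal (T h)) by (apply (C0_linear _ HT); lra).
replace (minus (scal (/ h) (minus (scal r (T h x)) (scal r x))) (scal r y))
  with (scal r (minus (scal (/ h) (minus (T h x) x)) y)) by (module_eq; lra).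
eapply Rle_lt_trans; [apply norm_scal_le|].
apply Rle_lt_trans with (Rabs r * (eps / (Rabs r + 1))).
- apply Rmult_le_compat_l; auto; left; auto.
- apply Rlt_le_trans with ((Rabs r + 1) * (eps / (Rabs r + 1))).
  + apply Rmult_lt_compat_r; [apply Rdiv_lt_0_compat|]; lra.
  + right; field; lra.
Qed.

Lemma generates_semigroup {X : CompleteNormedModule R_AbsRing}
    (T : R -> X -> X) (t : R) (x y : X) :
  C0_semigroup T -> 0 <= t -> generates T x y -> generates T (T t x) (T t y).
Proof.
intros HT Ht H; apply generates_iff; intros eps He.
assert (HL := C0_linear _ HT t Ht).
destruct (lin_close (T t) y eps HL He) as (e & Hpos & He').
destruct (proj1 (generates_iff _ _ _) H e Hpos) as (d & Hd & Hd').
exists d; split; auto; intros h Hh.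
rewrite <- (C0_add _ HT), Rplus_comm, (C0_add _ HT) by lra.
rewrite <- (lin_minus (T t)), <- (lin_scal (T t)) by auto; auto.
Qed.

Lemma mean_value_limit {X : CompleteNormedModule R_AbsRing} (f : R -> X) a eps :
  (forall t, continuous f t) -> 0 < eps ->
  exists delta, 0 < delta /\ forall h, 0 < h < delta ->
    norm (minus (scal (/ h) (RInt f a (a + h))) (f a)) < eps.
Proof.
intros Hf He.
destruct (proj1 (continuous_norm_iff f a) (Hf a) (eps / 2)) as (d & Hd & Hd');
  [lra|].
exists d; split; auto; intros h Hh.
assert (Hc : RInt (fun _ => f a) a (a + h) = scal h (f a)).
{ etransitivity; [exact (RInt_const a (a + h) (f a))|].
  replace (a + h - a) with h by ring; reflexivity. }
replace (minus (scal (/ h) (RInt f a (a + h))) (f a))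
  with (scal (/ h) (RInt (fun t => minus (f t) (f a)) a (a + h))).
- eapply Rle_lt_trans; [apply norm_scal_le|].
  rewrite Rabs_right by (left; apply Rinv_0_lt_compat; lra).
  apply Rle_lt_trans with (/ h * ((a + h - a) * (eps / 2))).
  + apply Rmult_le_compat_l; [left; apply Rinv_0_lt_compat; lra|].
    apply RInt_norm_le_const; [lra| |].
    * intros t; apply (continuous_minus f (fun _ => f a)); auto.
      apply continuous_const.
    * intros t Ht; left; apply Hd'; rewrite Rabs_right; lra.
  + replace (/ h * ((a + h - a) * (eps / 2))) with (eps / 2) by (field; lra).
    lra.
- rewrite RInt_minus_cont; auto.
  + rewrite Hc; module_eq; lra.
  + intros; apply continuous_const.
Qed.

(** Applying [T h] shifts the interval of integration by [h]; what remains of the difference is the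
    integral over [[b, b + h]] minus that over [[0, h]]. *)
Lemma generates_RInt {X : CompleteNormedModule R_AbsRing} (T : R -> X -> X)
    (b : R) (x : X) :
  C0_semigroup T -> 0 <= b ->
  generates T (RInt (fun s => clamp T s x) 0 b) (minus (T b x) x).
Proof.
intros HT Hb; apply generates_iff; intros eps He.
set (f := fun s => clamp T s x).
assert (Hf : forall t, continuous f t) by (intros; apply C0_clamp_cont; auto).
destruct (mean_value_limit f b (eps / 2) Hf) as (d & Hd & Hd'); [lra|].
destruct (mean_value_limit f 0 (eps / 2) Hf) as (e & Hpos & He'); [lra|].
exists (Rmin d e); split; [apply Rmin_pos; auto|]; intros h Hh.
specialize (Hd' h ltac:(generalize (Rmin_l d e); lra)).
specialize (He' h ltac:(generalize (Rmin_r d e); lra)).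
assert (E : T h (RInt f 0 b) = RInt f h (b + h)).
{ rewrite <- RInt_linear by (auto; apply (C0_linear _ HT); lra).
  transitivity (RInt (fun s => f (s + h)) 0 b);
    [|rewrite RInt_shift, Rplus_0_l; auto].
  apply RInt_ext; intros s.
  rewrite Rmin_left, Rmax_right by auto; intros Hs.
  unfold f; rewrite !clamp_pos by lra.
  rewrite (Rplus_comm s), (C0_add _ HT) by lra; auto. }
assert (E1 := RInt_Chasles_cont f 0 h (b + h) Hf).
rewrite (RInt_Chasles_cont f 0 b (b + h) Hf) in E1.
rewrite Rplus_0_l in He'.
replace (T b x) with (f b) by (unfold f; rewrite (clamp_pos T b); auto).
replace (minus (f b) x) with (minus (f b) (f 0))
  by (unfold f; rewrite (clamp_pos T 0), (C0_zero _ HT); auto; lra).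
rewrite E.
replace (RInt f h (b + h))
  with (minus (plus (RInt f 0 b) (RInt f b (b + h))) (RInt f 0 h))
  by (rewrite E1; module_eq).
replace (minus (scal (/ h) (minus (minus (plus (RInt f 0 b) (RInt f b (b + h)))
     (RInt f 0 h)) (RInt f 0 b))) (minus (f b) (f 0)))
  with (minus (minus (scal (/ h) (RInt f b (b + h))) (f b))
              (minus (scal (/ h) (RInt f 0 h)) (f 0))) by (module_eq; lra).
eapply Rle_lt_trans; [apply norm_minus_le|lra].
Qed.

(** Instead of differentiating the orbit, both sides are recognised as the generator applied to the
    integral of [T s x]: the right side by [generates_RInt], the left one by taking the difference
    quotient inside the integral. *)
Lemma generates_FTC {X : CompleteNormedModule R_AbsRing} (T : R -> X -> X)
    (b : R) (x y : X) :
  C0_semigroup T -> 0 <= b -> generates T x y ->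
  RInt (fun s => clamp T s y) 0 b = minus (T b x) x.
Proof.
intros HT Hb H.
apply (generates_unique T (RInt (fun s => clamp T s x) 0 b));
  [|apply generates_RInt; auto].
apply generates_iff; intros eps He.
destruct (C0_bounded T b HT) as (c & Hc & Hbound).
assert (He' : 0 < eps / (c * (b + 1))).
{ apply Rdiv_lt_0_compat; auto; apply Rmult_lt_0_compat; lra. }
destruct (proj1 (generates_iff _ _ _) H _ He') as (d & Hd & Hd').
exists d; split; auto; intros h Hh; specialize (Hd' h Hh).
set (z := minus (scal (/ h) (minus (T h x) x)) y) in *.
assert (Hcont : forall w t, continuous (fun s => clamp T s w) t)
  by (intros; apply C0_clamp_cont; auto).
assert (E : T h (RInt (fun s => clamp T s x) 0 b) =
            RInt (fun s => clamp T s (T h x)) 0 b).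
{ rewrite <- RInt_linear by (auto; apply (C0_linear _ HT); lra).
  apply RInt_ext; intros s.
  rewrite Rmin_left, Rmax_right by auto; intros Hs.
  rewrite !clamp_pos by lra.
  rewrite <- !(C0_add _ HT), Rplus_comm by lra; auto. }
rewrite E.
replace (minus (scal (/ h) (minus (RInt (fun s => clamp T s (T h x)) 0 b)
    (RInt (fun s => clamp T s x) 0 b))) (RInt (fun s => clamp T s y) 0 b))
  with (RInt (fun s => clamp T s z) 0 b).
- eapply Rle_lt_trans.
  + apply RInt_norm_le_const; auto.
    intros s Hs; rewrite clamp_pos by lra.
    apply Rle_trans with (c * (eps / (c * (b + 1)))).
    * eapply Rle_trans; [apply Hbound; lra|].
      apply Rmult_le_compat_l; lra.
    * right; reflexivity.
  + replace ((b - 0) * (c * (eps / (c * (b + 1))))) with (b * (eps / (b + 1)))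
      by (field; split; lra).
    apply Rlt_le_trans with ((b + 1) * (eps / (b + 1))).
    * apply Rmult_lt_compat_r; [apply Rdiv_lt_0_compat|]; lra.
    * right; field; lra.
- rewrite <- RInt_minus_cont, <- RInt_scal_cont by
    (intros; try apply (continuous_minus (fun s => clamp T s (T h x))); auto).
  rewrite <- RInt_minus_cont; auto.
  + apply RInt_ext; intros s.
    rewrite Rmin_left, Rmax_right by auto; intros Hs.
    assert (HL : is_linear (T s)) by (apply (C0_linear _ HT); lra).
    rewrite !clamp_pos by lra; unfold z.
    rewrite (lin_minus (T s)), (lin_scal (T s)), (lin_minus (T s)) by auto.
    reflexivity.
  + intros t; apply (continuous_scal_r (/ h)
      (fun s => minus (clamp T s (T h x)) (clamp T s x))).
    apply (continuous_minus (fun s => clamp T s (T h x))); auto.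
Qed.

(** Averages of an orbit over short intervals lie in the domain and tend to its starting point. *)
Lemma generates_dense {X : CompleteNormedModule R_AbsRing} (T : R -> X -> X) :
  C0_semigroup T -> dense (fun x => exists y, generates T x y).
Proof.
intros HT x eps He.
destruct (mean_value_limit (fun s => clamp T s x) 0 eps) as (d & Hd & Hd'); auto.
{ intros; apply C0_clamp_cont; auto. }
exists (scal (/ (d / 2)) (RInt (fun s => clamp T s x) 0 (d / 2))); split.
- exists (scal (/ (d / 2)) (minus (T (d / 2) x) x)).
  apply generates_scal; auto; apply generates_RInt; auto; lra.
- specialize (Hd' (d / 2) ltac:(lra)).
  rewrite Rplus_0_l, (clamp_pos T 0), (C0_zero _ HT) in Hd' by lra; auto.
Qed.

Definition rescale {X : CompleteNormedModule R_AbsRing} (mu : R)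
    (T : R -> X -> X) (t : R) (x : X) : X := scal (exp (mu * t)) (T t x).

Lemma rescale_C0 {X : CompleteNormedModule R_AbsRing} (mu : R) (T : R -> X -> X) :
  C0_semigroup T -> C0_semigroup (rescale mu T).
Proof.
intros HT; unfold rescale; split.
- intros t Ht; destruct (C0_bounded T t HT) as (c & Hc & Hb).
  assert (HL := C0_linear _ HT t Ht).
  apply (is_linear_intro _ (exp (mu * t) * c)).
  + intros x y; rewrite (lin_plus (T t)) by auto; module_eq.
  + intros r x; rewrite (lin_scal (T t)) by auto; module_eq.
  + intros x; eapply Rle_trans; [apply norm_scal_le|].
    rewrite Rabs_right by (left; apply exp_pos); rewrite Rmult_assoc.
    apply Rmult_le_compat_l; [left; apply exp_pos|apply Hb; lra].
- intros x; rewrite Rmult_0_r, exp_0, (C0_zero _ HT).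
  change (scal 1 x = x); module_eq.
- intros s t x Hs Ht.
  rewrite (C0_add _ HT), (lin_scal (T s)) by (auto; apply (C0_linear _ HT); lra).
  rewrite Rmult_plus_distr_l, exp_plus; module_eq.
- intros x.
  apply filterlim_right_norm; intros eps He.
  set (f := fun s => scal (exp (mu * s)) (clamp T s x)).
  assert (Hf : continuous f 0).
  { apply (continuous_scal (fun s => exp (mu * s)) (fun s => clamp T s x)).
    - apply (continuous_comp (fun s => mu * s) exp).
      + apply (continuous_scal_r mu (fun s : R => s)), continuous_id.
      + apply continuous_exp.
    - apply C0_clamp_cont; auto. }
  destruct (proj1 (continuous_norm_iff _ _) Hf eps He) as (d & Hd & Hd').
  exists d; split; auto; intros h Hh.
  assert (H : norm (minus (f h) (f 0)) < eps).
  { apply Hd'; rewrite Rabs_right; lra. }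
  unfold f in H; rewrite !clamp_pos in H by lra.
  rewrite Rmult_0_r, exp_0, (C0_zero _ HT) in H.
  replace (scal 1 x) with x in H by module_eq; exact H.
Qed.

Lemma exp_right_derivative (mu eps : R) :
  0 < eps -> exists delta, 0 < delta /\
  forall h, 0 < h < delta -> Rabs ((exp (mu * h) - 1) / h - mu) < eps.
Proof.
intros He.
assert (Hd : is_derive (fun h => exp (mu * h)) 0 mu).
{ auto_derive; auto; rewrite Rmult_0_r, exp_0; ring. }
apply is_derive_Reals in Hd.
destruct (Hd eps He) as [d Hd'].
exists d; split; [apply cond_pos|]; intros h Hh.
specialize (Hd' h ltac:(lra)); rewrite Rplus_0_l, Rmult_0_r, exp_0 in Hd'.
apply Hd'; rewrite Rabs_right; lra.
Qed.

(** The product rule at 0. With [k = (exp (mu * h) - 1) / h] and [z] the error of the difference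
    quotient of [T], the new error is [(1 + h k) z + h k y + (k - mu) x]. *)
Lemma rescale_generates {X : CompleteNormedModule R_AbsRing} (mu : R)
    (T : R -> X -> X) (x y : X) :
  generates T x y -> generates (rescale mu T) x (plus y (scal mu x)).
Proof.
intros H; apply generates_iff; intros eps He.
assert (Hx := norm_ge_0 x); assert (Hy := norm_ge_0 y).
(* [e1] bounds [|k - mu|], and [2 * e1] bounds [|h k|]. The cap 1 gives [|h k| <= 2], so the part in
   [z] stays below [3 eps / 8] once [norm z < eps / 8]; the rest is at most [eps / 2]. *)
set (e1 := Rmin 1 (eps / (4 * (norm y + norm x + 1)))).
assert (He1 : 0 < e1).
{ apply Rmin_pos; [lra|apply Rdiv_lt_0_compat; lra]. }
assert (He2 : e1 * (norm y + norm x) <= eps / 4).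
{ apply Rle_trans with (eps / (4 * (norm y + norm x + 1)) * (norm y + norm x + 1)).
  - apply Rmult_le_compat; [lra|lra|apply Rmin_r|lra].
  - right; field; lra. }
destruct (proj1 (generates_iff _ _ _) H (eps / 8)) as (d & Hd & Hd'); [lra|].
destruct (exp_right_derivative mu e1 He1) as (d2 & Hd2 & Hd2').
set (d3 := e1 / (Rabs mu + 1)).
assert (Hmu := Rabs_pos mu).
assert (Hd3 : 0 < d3) by (apply Rdiv_lt_0_compat; lra).
exists (Rmin d (Rmin d2 d3)); split; [repeat apply Rmin_pos; auto|].
intros h Hh.
assert (Hh1 : 0 < h < d) by (generalize (Rmin_l d (Rmin d2 d3)); lra).
assert (Hh2 : 0 < h < d2)
  by (generalize (Rmin_r d (Rmin d2 d3)) (Rmin_l d2 d3); lra).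
assert (Hh3 : 0 < h < d3)
  by (generalize (Rmin_r d (Rmin d2 d3)) (Rmin_r d2 d3); lra).
specialize (Hd' h Hh1); specialize (Hd2' h Hh2).
set (z := minus (scal (/ h) (minus (T h x) x)) y) in *.
set (k := (exp (mu * h) - 1) / h) in *.
assert (Ek : exp (mu * h) = 1 + h * k) by (unfold k; field; lra).
assert (Hhk : Rabs (h * k) <= 2 * e1).
{ replace (h * k) with (h * (k - mu) + h * mu) by ring.
  eapply Rle_trans; [apply Rabs_triang|].
  rewrite !Rabs_mult, (Rabs_right h) by lra.
  assert (Hd31 : d3 <= 1).
  { unfold d3; apply Rmult_le_reg_r with (Rabs mu + 1); [lra|].
    replace (e1 / (Rabs mu + 1) * (Rabs mu + 1)) with e1 by (field; lra).
    generalize (Rmin_l 1 (eps / (4 * (norm y + norm x + 1)))); fold e1; lra. }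
  assert (H1 : h * Rabs (k - mu) <= 1 * e1).
  { apply Rmult_le_compat; try lra; apply Rabs_pos. }
  assert (H2 : h * Rabs mu <= d3 * (Rabs mu + 1)).
  { apply Rmult_le_compat; lra. }
  replace (d3 * (Rabs mu + 1)) with e1 in H2 by (unfold d3; field; lra).
  lra. }
assert (Hhk1 : Rabs (h * k) <= 2).
{ generalize (Rmin_l 1 (eps / (4 * (norm y + norm x + 1)))); fold e1; lra. }
unfold rescale; rewrite Ek.
replace (minus (scal (/ h) (minus (scal (1 + h * k) (T h x)) x))
   (plus y (scal mu x)))
  with (plus (plus z (scal (h * k) z))
             (plus (scal (h * k) y) (scal (k - mu) x)))
  by (unfold z; module_eq; lra).
eapply Rle_lt_trans; [apply norm_plus_le|].
eapply Rle_lt_trans; [apply Rplus_le_compat; apply norm_plus_le|].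
generalize (norm_scal_le (h * k) z) (norm_scal_le (h * k) y)
  (norm_scal_le (k - mu) x) (norm_ge_0 z); intros H1 H2 H3 H4.
assert (H5 : Rabs (h * k) * norm z <= 2 * norm z)
  by (apply Rmult_le_compat_r; auto).
assert (H6 : Rabs (h * k) * norm y <= 2 * e1 * norm y)
  by (apply Rmult_le_compat_r; auto).
assert (H7 : Rabs (k - mu) * norm x <= e1 * norm x)
  by (apply Rmult_le_compat_r; lra).
assert (H8 : 0 <= e1 * norm y) by (apply Rmult_le_pos; lra).
assert (H9 : 0 <= e1 * norm x) by (apply Rmult_le_pos; lra).
lra.
Qed.

(** * Strongly continuous families of operators *)

(** The bound is uniform over all real times; families on the half-line enter after clamping.
    Keeping [c] explicit lets each application of [V] be tracked as multiplication by [q]. *)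
Record sc_family {X : CompleteNormedModule R_AbsRing} (P : R -> X -> X)
    (c : R) : Prop := {
  sc_linear : forall t, is_linear (P t);
  sc_bound : forall t x, norm (P t x) <= c * norm x;
  sc_cont : forall x t, continuous (fun s => P s x) t
}.

(** The uniform bound upgrades strong continuity to joint continuity, needed because in the
    integrand of [V] both the time and the vector move. *)
Lemma sc_joint {X : CompleteNormedModule R_AbsRing} (P : R -> X -> X) c t y eps :
  sc_family P c -> 0 < eps ->
  exists delta, 0 < delta /\ forall t' y', Rabs (t' - t) < delta ->
    norm (minus y' y) < delta -> norm (minus (P t' y') (P t y)) < eps.
Proof.
intros HP He; assert (Hc := Rabs_pos c).
destruct (proj1 (continuous_norm_iff _ _) (sc_cont _ _ HP y t) (eps / 2))
  as (d & Hd & Hd'); [lra|].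
assert (H : 0 < eps / (2 * (Rabs c + 1))) by (apply Rdiv_lt_0_compat; lra).
exists (Rmin d (eps / (2 * (Rabs c + 1)))); split; [apply Rmin_pos; auto|].
intros t' y' Ht Hy.
eapply Rle_lt_trans; [apply norm_minus_triangle with (y := P t' y)|].
assert (H1 : norm (minus (P t' y) (P t y)) < eps / 2)
  by (apply Hd'; eapply Rlt_le_trans; [apply Ht|apply Rmin_l]).
assert (H2 : norm (minus (P t' y') (P t' y)) <= eps / 2).
{ rewrite <- (lin_minus (P t')) by apply (sc_linear _ _ HP).
  eapply Rle_trans; [apply (sc_bound _ _ HP)|].
  apply Rle_trans with ((Rabs c + 1) * (eps / (2 * (Rabs c + 1)))).
  - apply Rle_trans with ((Rabs c + 1) * norm (minus y' y)).
    + apply Rmult_le_compat_r; [apply norm_ge_0|].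
      generalize (Rle_abs c); lra.
    + apply Rmult_le_compat_l; [lra|].
      left; eapply Rlt_le_trans; [apply Hy|apply Rmin_r].
  - right; field; lra. }
lra.
Qed.

Lemma sc_comp_cont {X : CompleteNormedModule R_AbsRing} (P : R -> X -> X) c
    (phi : R -> R) (g : R -> X) t :
  sc_family P c -> continuous phi t -> continuous g t ->
  continuous (fun s => P (phi s) (g s)) t.
Proof.
intros HP Hphi Hg; apply continuous_norm_iff; intros eps He.
destruct (sc_joint P c (phi t) (g t) eps HP He) as (e & Hpos & Hj).
destruct (proj1 (continuous_norm_iff (V := R_CompleteNormedModule) _ _) Hphi e Hpos)
  as (d1 & Hd1 & H1).
destruct (proj1 (continuous_norm_iff _ _) Hg e Hpos) as (d2 & Hd2 & H2).
exists (Rmin d1 d2); split; [apply Rmin_pos; auto|].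
intros s Hs; apply Hj.
- apply (H1 s); eapply Rlt_le_trans; [apply Hs|apply Rmin_l].
- apply (H2 s); eapply Rlt_le_trans; [apply Hs|apply Rmin_r].
Qed.

Lemma continuous_dense {X : CompleteNormedModule R_AbsRing} (Q : R -> X -> X)
    (P : X -> Prop) c :
  (forall t, is_linear (Q t)) -> (forall t x, norm (Q t x) <= c * norm x) ->
  dense P -> (forall x t, P x -> continuous (fun s => Q s x) t) ->
  forall x t, continuous (fun s => Q s x) t.
Proof.
intros HL Hb HP H x t; apply continuous_norm_iff; intros eps He.
assert (Hc := Rabs_pos c).
assert (He' : 0 < eps / (4 * (Rabs c + 1))) by (apply Rdiv_lt_0_compat; lra).
destruct (HP x _ He') as (y & Hy & Hyx).
assert (Hclose : forall s, norm (minus (Q s x) (Q s y)) <= eps / 4).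
{ intros s; rewrite <- (lin_minus (Q s)) by auto.
  eapply Rle_trans; [apply Hb|]; rewrite norm_minus_sym.
  apply Rle_trans with ((Rabs c + 1) * (eps / (4 * (Rabs c + 1)))).
  - apply Rle_trans with ((Rabs c + 1) * norm (minus y x)).
    + apply Rmult_le_compat_r; [apply norm_ge_0|].
      generalize (Rle_abs c); lra.
    + apply Rmult_le_compat_l; lra.
  - right; field; lra. }
destruct (proj1 (continuous_norm_iff _ _) (H y t Hy) (eps / 4)) as (d & Hd & Hd');
  [lra|].
exists d; split; auto; intros s Hs; specialize (Hd' s Hs).
eapply Rle_lt_trans; [apply norm_minus_triangle with (y := Q s y)|].
eapply Rle_lt_trans;
  [apply Rplus_le_compat_l, norm_minus_triangle with (y := Q t y)|].
generalize (Hclose s) (Hclose t); rewrite (norm_minus_sym (Q t x)); lra.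
Qed.

(** At each vector the convergence is uniform in time, so strong continuity passes to the limit. [C]
    is a common bound of the families, while [c] only measures the increments. *)
Lemma sc_family_limit {X : CompleteNormedModule R_AbsRing}
    (S : nat -> R -> X -> X) (C c q : R) :
  0 <= q < 1 -> (forall n, sc_family (S n) C) ->
  (forall n t x, norm (minus (S (n + 1)%nat t x) (S n t x)) <= c * norm x * q ^ n) ->
  exists S', sc_family S' C /\ forall n t x,
    norm (minus (S' t x) (S n t x)) <= c * norm x * q ^ n / (1 - q).
Proof.
intros Hq HS Hd.
assert (Hex : forall p : R * X, exists l : X, forall n,
  norm (minus l (S n (fst p) (snd p))) <= c * norm (snd p) * q ^ n / (1 - q)).
{ intros [t x]; apply (geometric_limit (fun n => S n t x)); auto.
  intros n; rewrite <- Nat.add_1_r; apply Hd. }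
destruct (choice _ Hex) as [l Hl].
set (S' := fun t x => l (t, x)).
assert (HS' : forall n t x,
  norm (minus (S' t x) (S n t x)) <= c * norm x * q ^ n / (1 - q))
  by (intros n t x; apply (Hl (t, x))).
assert (Hsmall : forall x eps, 0 < eps ->
  exists n, forall t, norm (minus (S' t x) (S n t x)) < eps).
{ intros x eps He.
  destruct (pow_small q (c * norm x / (1 - q)) eps Hq He) as [n Hn].
  exists n; intros t; eapply Rle_lt_trans; [apply HS'|].
  replace (c * norm x * q ^ n / (1 - q)) with (c * norm x / (1 - q) * q ^ n)
    by (field; lra); auto. }
assert (Hsmall3 : forall t (x y z : X) eps, 0 < eps -> exists n,
  norm (minus (S' t x) (S n t x)) < eps /\
  norm (minus (S' t y) (S n t y)) < eps /\
  norm (minus (S' t z) (S n t z)) < eps).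
{ intros t x y z eps He.
  set (m := Rabs c * (norm x + norm y + norm z) / (1 - q)).
  destruct (pow_small q m eps Hq He) as [n Hn].
  assert (Hle : forall w, norm w <= norm x + norm y + norm z ->
    norm (minus (S' t w) (S n t w)) < eps).
  { intros w Hw; eapply Rle_lt_trans; [apply HS'|].
    eapply Rle_lt_trans; [|apply Hn].
    unfold m; replace (Rabs c * (norm x + norm y + norm z) / (1 - q) * q ^ n)
      with (Rabs c * (norm x + norm y + norm z) * q ^ n / (1 - q))
      by (field; lra).
    apply Rmult_le_compat_r; [left; apply Rinv_0_lt_compat; lra|].
    apply Rmult_le_compat_r; [apply pow_le; lra|].
    apply Rle_trans with (Rabs c * norm w).
    - apply Rmult_le_compat_r; [apply norm_ge_0|apply Rle_abs].
    - apply Rmult_le_compat_l; auto; apply Rabs_pos. }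
  generalize (norm_ge_0 x) (norm_ge_0 y) (norm_ge_0 z); intros.
  exists n; repeat split; apply Hle; lra. }
exists S'; split; auto.
assert (Hbd : forall t x, norm (S' t x) <= C * norm x).
{ intros t x; apply Rle_plus_epsilon; intros eps He.
  destruct (Hsmall x eps He) as [n Hn].
  generalize (norm_le_minus (S' t x) (S n t x)) (Hn t)
    (sc_bound _ _ (HS n) t x); lra. }
split; auto.
- intros t; apply (is_linear_intro _ C); auto.
  + intros x y; apply norm_minus_eq; intros eps He.
    destruct (Hsmall3 t x y (plus x y) (eps / 3)) as (n & H1 & H2 & H3); [lra|].
    rewrite (lin_plus (S n t)) in H3 by apply (sc_linear _ _ (HS n)).
    replace (minus (S' t (plus x y)) (plus (S' t x) (S' t y)))
      with (minus (minus (S' t (plus x y)) (plus (S n t x) (S n t y)))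
             (plus (minus (S' t x) (S n t x)) (minus (S' t y) (S n t y))))
      by module_eq.
    eapply Rle_trans; [apply norm_minus_le|].
    eapply Rle_trans; [apply Rplus_le_compat_l, norm_plus_le|]; lra.
  + intros r x; apply norm_minus_eq; intros eps He.
    assert (Hr := Rabs_pos r).
    destruct (Hsmall3 t x x (scal r x) (eps / (Rabs r + 1))) as (n & H1 & _ & H3).
    { apply Rdiv_lt_0_compat; lra. }
    rewrite (lin_scal (S n t)) in H3 by apply (sc_linear _ _ (HS n)).
    replace (minus (S' t (scal r x)) (scal r (S' t x)))
      with (minus (minus (S' t (scal r x)) (scal r (S n t x)))
             (scal r (minus (S' t x) (S n t x)))) by module_eq.
    eapply Rle_trans; [apply norm_minus_le|].
    eapply Rle_trans; [apply Rplus_le_compat_l, norm_scal_le|].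
    assert (H4 : Rabs r * norm (minus (S' t x) (S n t x))
                 <= Rabs r * (eps / (Rabs r + 1)))
      by (apply Rmult_le_compat_l; lra).
    replace eps with (eps / (Rabs r + 1) + Rabs r * (eps / (Rabs r + 1)))
      by (field; lra).
    lra.
- intros x t; apply continuous_norm_iff; intros eps He.
  destruct (Hsmall x (eps / 3)) as [n Hn]; [lra|].
  destruct (proj1 (continuous_norm_iff _ _) (sc_cont _ _ (HS n) x t) (eps / 3))
    as (d & Hpos & Hd'); [lra|].
  exists d; split; auto; intros s Hs; specialize (Hd' s Hs).
  eapply Rle_lt_trans; [apply norm_minus_triangle with (y := S n s x)|].
  eapply Rle_lt_trans;
    [apply Rplus_le_compat_l, norm_minus_triangle with (y := S n t x)|].
  generalize (Hn s) (Hn t); rewrite (norm_minus_sym (S' t x)); lra.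
Qed.

Lemma sc_family_plus {X : CompleteNormedModule R_AbsRing} (P Q : R -> X -> X)
    c d :
  sc_family P c -> sc_family Q d ->
  sc_family (fun t x => plus (P t x) (Q t x)) (c + d).
Proof.
intros HP HQ.
assert (Hb : forall t x, norm (plus (P t x) (Q t x)) <= (c + d) * norm x).
{ intros t x; eapply Rle_trans; [apply norm_plus_le|].
  rewrite Rmult_plus_distr_r; apply Rplus_le_compat;
    [apply (sc_bound _ _ HP)|apply (sc_bound _ _ HQ)]. }
split; auto.
- intros t; apply (is_linear_intro _ (c + d)); auto.
  + intros x y; rewrite (lin_plus (P t)), (lin_plus (Q t)) by
      (apply (sc_linear _ _ HP) || apply (sc_linear _ _ HQ)); module_eq.
  + intros r x; rewrite (lin_scal (P t)), (lin_scal (Q t)) by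
      (apply (sc_linear _ _ HP) || apply (sc_linear _ _ HQ)); module_eq.
- intros x t; apply (continuous_plus (fun s => P s x) (fun s => Q s x));
    [apply (sc_cont _ _ HP)|apply (sc_cont _ _ HQ)].
Qed.

Lemma sc_family_weaken {X : CompleteNormedModule R_AbsRing} (P : R -> X -> X)
    c d :
  sc_family P c -> (forall t x, norm (P t x) <= d * norm x) -> sc_family P d.
Proof. intros [H1 H2 H3] H; split; auto. Qed.

(** * Perturbations bounded in the graph norm *)

Lemma continuous_Rmax_0 t : continuous (Rmax 0) t.
Proof.
apply (continuous_norm_iff (V := R_CompleteNormedModule)); intros eps He.
exists eps; split; auto; intros s Hs.
change (Rabs (Rmax 0 s - Rmax 0 t) < eps).
apply Rabs_def2 in Hs; apply Rabs_def1; unfold Rmax;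
  destruct (Rle_dec 0 s), (Rle_dec 0 t); lra.
Qed.

Section Perturbation.
Context {X : CompleteNormedModule R_AbsRing}.
Context (A : operator X) (T : R -> X -> X) (D : X -> X).
Context (HT : C0_semigroup T) (HA : is_generator A T) (HD : is_linear_X1 A D).

Lemma op_generates x : op_dom A x -> generates T x (op_app A x).
Proof. intros Hx; exact (proj1 (HA x (op_app A x)) (conj Hx eq_refl)). Qed.

Lemma generates_op x y : generates T x y -> op_dom A x /\ op_app A x = y.
Proof. exact (proj2 (HA x y)). Qed.

Lemma op_dom_subspace : subspace (op_dom A).
Proof.
split.
- intros x y Hx Hy.
  apply (generates_op (plus x y) (plus (op_app A x) (op_app A y))).
  apply generates_plus; auto using op_generates.
- intros r x Hx; apply (generates_op (scal r x) (scal r (op_app A x))).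
  apply generates_scal; auto using op_generates.
Qed.

Lemma op_dom_dense : dense (op_dom A).
Proof.
intros x eps He; destruct (generates_dense T HT x eps He) as (y & [z Hz] & Hy).
exists y; split; auto; apply (generates_op y z); auto.
Qed.

Lemma op_app_linear_on : linear_on (op_dom A) (op_app A).
Proof.
split.
- intros x y Hx Hy; apply generates_op.
  apply generates_plus; auto using op_generates.
- intros r x Hx; apply generates_op.
  apply generates_scal; auto using op_generates.
Qed.

Lemma perturbation_linear_on : linear_on (op_dom A) D.
Proof. destruct HD as [H1 H2 _]; split; [exact H1|exact H2]. Qed.

Lemma orbit_dom s x : op_dom A x ->
  op_dom A (clamp T s x) /\ op_app A (clamp T s x) = clamp T s (op_app A x).
Proof.
intros Hx; apply generates_op.
apply (generates_semigroup T (Rmax 0 s)); auto using op_generates.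
apply Rmax_l.
Qed.

(** On [dom A] both [T s x] and [A T s x = T s A x] are continuous in [s], so the orbit is
    continuous in the graph norm, for which [D] is bounded. *)
Lemma perturbed_orbit_cont x t : op_dom A x ->
  continuous (fun s => D (clamp T s x)) t.
Proof.
intros Hx; destruct (X1_norm _ _ HD) as (M & HM & Hb).
apply continuous_norm_iff; intros eps He.
assert (He' : 0 < eps / (2 * M)) by (apply Rdiv_lt_0_compat; lra).
destruct (proj1 (continuous_norm_iff _ _) (C0_clamp_cont T x t HT) _ He')
  as (d1 & Hd1 & H1).
destruct (proj1 (continuous_norm_iff _ _) (C0_clamp_cont T (op_app A x) t HT) _ He')
  as (d2 & Hd2 & H2).
exists (Rmin d1 d2); split; [apply Rmin_pos; auto|]; intros s Hs.
specialize (H1 s (Rlt_le_trans _ _ _ Hs (Rmin_l _ _))).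
specialize (H2 s (Rlt_le_trans _ _ _ Hs (Rmin_r _ _))).
assert (HP := op_dom_subspace).
destruct (orbit_dom s x Hx) as [H3 H4]; destruct (orbit_dom t x Hx) as [H5 H6].
rewrite <- (linear_on_minus (op_dom A) D) by auto using perturbation_linear_on.
eapply Rle_lt_trans; [apply Hb, subspace_minus; auto|]; unfold graph_norm.
rewrite (linear_on_minus (op_dom A) (op_app A)), H4, H6
  by auto using op_app_linear_on.
replace eps with (M * (eps / (2 * M) + eps / (2 * M))) by (field; lra).
apply Rmult_lt_compat_l; auto; apply Rplus_lt_compat; [exact H1|exact H2].
Qed.

(** [D] passes through the integral because [A] does, and [A] does because [generates_RInt] and
    [generates_FTC] produce the same vector [T b x - x]. *)
Lemma perturbation_RInt x b : 0 <= b -> op_dom A x ->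
  RInt (fun s => D (clamp T s x)) 0 b = D (RInt (fun s => clamp T s x) 0 b).
Proof.
intros Hb Hx; destruct (X1_norm _ _ HD) as (M & HM & HMb).
destruct (generates_op _ _ (generates_RInt T b x HT Hb)) as [H1 H2].
apply is_RInt_unique.
apply (is_RInt_graph_bounded (op_dom A) (op_app A) D _ 0 b _ M); auto.
- apply op_dom_subspace.
- apply op_app_linear_on.
- apply perturbation_linear_on.
- intros s; apply orbit_dom; auto.
- apply is_RInt_cont; intros; apply C0_clamp_cont; auto.
- rewrite H2, <- (generates_FTC T b x (op_app A x)) by auto using op_generates.
  apply (is_RInt_ext (fun s => clamp T s (op_app A x))).
  + intros s _; symmetry; apply orbit_dom; auto.
  + apply is_RInt_cont; intros; apply C0_clamp_cont; auto.
Qed.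

Definition volterra (P : R -> X -> X) (x : X) (t : R) : X :=
  RInt (fun s => P (t - s) (D (clamp T s x))) 0 t.

Lemma volterra_integrand_cont P c x t s : sc_family P c -> op_dom A x ->
  continuous (fun s => P (t - s) (D (clamp T s x))) s.
Proof.
intros HP Hx; apply (sc_comp_cont P c (fun s => t - s)); auto.
- apply (continuous_minus (fun _ : R => t) (fun s : R => s));
    [apply continuous_const|apply continuous_id].
- apply perturbed_orbit_cont; auto.
Qed.

Lemma volterra_unit P c x t : sc_family P c -> op_dom A x ->
  volterra P x t =
  scal t (RInt (fun s => P (t - t * s) (D (clamp T (t * s) x))) 0 1).
Proof.
intros HP Hx; apply (RInt_to_unit (fun s => P (t - s) (D (clamp T s x))) t).
intros s; apply (volterra_integrand_cont P c); auto.
Qed.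

(** The mean [V P x t / t], extended to [t = 0]. Its continuity yields that of [volterra], and its
    value at 0 yields the derivative of [volterra] there. *)
Lemma volterra_kernel_cont P c x t : sc_family P c -> op_dom A x ->
  continuous (fun t => RInt (fun s => P (t - t * s) (D (clamp T (t * s) x))) 0 1) t.
Proof.
intros HP Hx.
apply (continuous_RInt_param (fun t s => P (t - t * s) (D (clamp T (t * s) x))));
  [lra|].
clear t; intros t s eps He.
destruct (sc_joint P c (t - t * s) (D (clamp T (t * s) x)) eps HP He)
  as (e & Hpos & Hj).
destruct (proj1 (continuous_norm_iff _ _)
  (perturbed_orbit_cont x (t * s) Hx) e Hpos) as (d & Hd & Hd').
set (m := Rmin e d).
assert (Hm : 0 < m) by (apply Rmin_pos; auto).
assert (Hts : 0 < 2 + Rabs s + Rabs t)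
  by (generalize (Rabs_pos s) (Rabs_pos t); lra).
(* Of the 2 in the denominator, one unit absorbs the product of the two increments, and the other
   leaves room for the term [t' - t] in the time argument of [P]. *)
exists (Rmin 1 (m / (2 + Rabs s + Rabs t))); split.
{ apply Rmin_pos; [lra|apply Rdiv_lt_0_compat; auto]. }
intros t' s' Ht Hs.
set (k := Rmin 1 (m / (2 + Rabs s + Rabs t))) in *.
assert (Hk1 : k <= 1) by apply Rmin_l.
assert (Hk2 : k * (2 + Rabs s + Rabs t) <= m).
{ apply Rle_trans with (m / (2 + Rabs s + Rabs t) * (2 + Rabs s + Rabs t)).
  - apply Rmult_le_compat_r; [lra|apply Rmin_r].
  - right; field; lra. }
assert (Hk0 : 0 < k) by (generalize (Rabs_pos (t' - t)); lra).
assert (H0 : Rabs (t' * s' - t * s) < m - k).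
{ replace (t' * s' - t * s)
    with ((t' - t) * (s' - s) + (t' - t) * s + t * (s' - s)) by ring.
  eapply Rle_lt_trans; [apply Rabs_triang|].
  eapply Rle_lt_trans; [apply Rplus_le_compat_r, Rabs_triang|].
  rewrite !Rabs_mult.
  assert (H1 : Rabs (t' - t) * Rabs (s' - s) <= Rabs (t' - t) * 1)
    by (apply Rmult_le_compat_l; [apply Rabs_pos|lra]).
  assert (H2 : Rabs (t' - t) * Rabs s <= k * Rabs s)
    by (apply Rmult_le_compat_r; [apply Rabs_pos|lra]).
  assert (H3 : Rabs t * Rabs (s' - s) <= Rabs t * k)
    by (apply Rmult_le_compat_l; [apply Rabs_pos|lra]).
  lra. }
apply Hj.
- replace (t' - t' * s' - (t - t * s)) with ((t' - t) - (t' * s' - t * s)) by ring.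
  eapply Rle_lt_trans; [apply Rabs_triang|]; rewrite Rabs_Ropp.
  generalize (Rmin_l e d); fold m; lra.
- apply Hd'; generalize (Rmin_r e d); fold m; lra.
Qed.

Lemma volterra_cont P c x t : sc_family P c -> op_dom A x ->
  continuous (volterra P x) t.
Proof.
intros HP Hx.
apply (continuous_ext (fun t =>
  scal t (RInt (fun s => P (t - t * s) (D (clamp T (t * s) x))) 0 1))).
- intros s; symmetry; apply (volterra_unit P c); auto.
- apply (continuous_scal (fun t : R => t)); [apply continuous_id|].
  apply (volterra_kernel_cont P c); auto.
Qed.

Lemma volterra_linear_on P c t : sc_family P c ->
  linear_on (op_dom A) (fun x => volterra P x t).
Proof.
intros HP.
assert (HL : forall s, is_linear (clamp T s))
  by (intros s; apply (C0_linear _ HT), Rmax_l).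
assert (HPL := sc_linear _ _ HP); assert (HDL := perturbation_linear_on).
split; unfold volterra.
- intros x y Hx Hy; rewrite <- RInt_plus_cont
    by (intros; apply (volterra_integrand_cont P c); auto).
  apply RInt_ext; intros s _.
  rewrite (lin_plus (clamp T s)), (proj1 HDL), (lin_plus (P (t - s)))
    by (auto; apply orbit_dom; auto); reflexivity.
- intros r x Hx; rewrite <- RInt_scal_cont
    by (intros; apply (volterra_integrand_cont P c); auto).
  apply RInt_ext; intros s _.
  rewrite (lin_scal (clamp T s)), (proj2 HDL), (lin_scal (P (t - s)))
    by (auto; apply orbit_dom; auto); reflexivity.
Qed.

Context (q : R) (Hq0 : 0 <= q).
Context (Hq : forall b x, 0 <= b -> op_dom A x ->
  RInt (fun s => norm (D (clamp T s x))) 0 b <= q * norm x).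

(** What counts is the total mass of [norm (D T(s) x)] over time, so [V] contracts by [q] although
    [D] is unbounded on [X]. [P] is asked only for a pointwise bound and a continuous integrand, so
    that the estimate also serves for differences and for the semigroup defect. *)
Lemma volterra_le (P : R -> X -> X) c x t :
  0 <= c -> 0 <= t -> op_dom A x ->
  (forall s, continuous (fun s => P (t - s) (D (clamp T s x))) s) ->
  (forall s y, 0 <= s -> norm (P s y) <= c * norm y) ->
  norm (volterra P x t) <= c * q * norm x.
Proof.
intros Hc Ht Hx Hcont HP.
assert (Hg : forall s, continuous (fun s => norm (D (clamp T s x))) s)
  by (intros; apply continuous_norm_comp, perturbed_orbit_cont; auto).
apply Rle_trans with (RInt (fun s => c * norm (D (clamp T s x))) 0 t).
- apply RInt_norm_le; auto.
  + intros s; apply (continuous_scal_r c (fun s => norm (D (clamp T s x)))); auto.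
  + intros s Hs; apply HP; lra.
- apply Rle_trans with (c * RInt (fun s => norm (D (clamp T s x))) 0 t).
  + right; exact (RInt_scal_cont (X := R_CompleteNormedModule)
      (fun s => norm (D (clamp T s x))) 0 t c Hg).
  + rewrite Rmult_assoc; apply Rmult_le_compat_l; auto.
Qed.

(** The bound [c * q] is in the norm of [X], not in the graph norm, so [V P] extends from [dom A] to
    [X] and [V] can be iterated. *)
Lemma volterra_family P c : 0 <= c -> sc_family P c ->
  exists Q, sc_family Q (c * q) /\
    forall x t, 0 <= t -> op_dom A x -> Q t x = volterra P x t.
Proof.
intros Hc HP.
assert (Hcq : 0 <= c * q) by (apply Rmult_le_pos; auto).
assert (Hex : forall t, exists L : X -> X, is_linear L /\
  (forall x, norm (L x) <= c * q * norm x) /\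
  forall x, op_dom A x -> L x = volterra P x (Rmax 0 t)).
{ intros t.
  apply (dense_extension (op_dom A) (fun x => volterra P x (Rmax 0 t)));
    auto using op_dom_subspace, op_dom_dense.
  - apply (volterra_linear_on P c); auto.
  - intros x Hx; apply volterra_le; auto; [apply Rmax_l| |].
    + intros; apply (volterra_integrand_cont P c); auto.
    + intros; apply (sc_bound _ _ HP). }
destruct (choice _ Hex) as [Q HQ].
exists Q; split; [split|].
- intros t; apply HQ.
- intros t; apply HQ.
- apply (continuous_dense Q (op_dom A) (c * q)); try apply HQ.
  + apply op_dom_dense.
  + intros x t Hx.
    apply (continuous_ext (fun t => volterra P x (Rmax 0 t))).
    * intros s; symmetry; apply HQ; auto.
    * apply (continuous_comp (Rmax 0) (volterra P x)).
      -- apply continuous_Rmax_0.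
      -- apply (volterra_cont P c); auto.
- intros x t Ht Hx; destruct (HQ t) as (_ & _ & E).
  rewrite E, Rmax_right; auto.
Qed.

End Perturbation.

(** * The fixed point of the Volterra map: semigroup law and generator *)

Lemma neumann {X : CompleteNormedModule R_AbsRing} (E : X -> X) r z :
  is_linear E -> 0 <= r < 1 -> (forall x, norm (E x) <= r * norm x) ->
  exists x, minus x (E x) = z.
Proof.
intros HE Hr Hb.
set (u := fix u n := match n with O => z | S m => plus z (E (u m)) end).
destruct (geometric_limit u (r * norm z) r Hr) as [l Hl].
{ induction n as [|n IH].
  - simpl; replace (minus (plus z (E z)) z) with (E z) by module_eq.
    rewrite Rmult_1_r; auto.
  - change (norm (minus (plus z (E (u (S n)))) (plus z (E (u n))))
            <= r * norm z * r ^ S n).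
    replace (minus (plus z (E (u (S n)))) (plus z (E (u n))))
      with (minus (E (u (S n))) (E (u n))) by module_eq.
    rewrite <- (lin_minus E) by auto.
    eapply Rle_trans; [apply Hb|]; simpl.
    apply Rmult_le_compat_l with (r := r) in IH; [|lra]; simpl in IH; lra. }
exists l; apply norm_minus_eq; intros eps He.
destruct (pow_small r (r * norm z / (1 - r)) (eps / 2) Hr) as [n Hn]; [lra|].
assert (Hz := norm_ge_0 z).
replace (minus (minus l (E l)) z)
  with (minus (minus l (u (S n))) (minus (E l) (E (u n))))
  by (simpl; module_eq).
rewrite <- (lin_minus E) by auto.
eapply Rle_trans; [apply norm_minus_le|].
assert (H1 : norm (minus l (u n)) <= eps / 2).
{ eapply Rle_trans; [apply Hl|].
  replace (r * norm z * r ^ n / (1 - r)) with (r * norm z / (1 - r) * r ^ n)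
    by (field; lra); lra. }
assert (H2 : norm (minus l (u (S n))) <= eps / 2).
{ eapply Rle_trans; [apply Hl|]; simpl.
  apply Rle_trans with (r * norm z / (1 - r) * r ^ n); [|lra].
  replace (r * norm z * (r * r ^ n) / (1 - r))
    with (r * (r * norm z / (1 - r) * r ^ n)) by (field; lra).
  rewrite <- (Rmult_1_l (r * norm z / (1 - r) * r ^ n)) at 2.
  apply Rmult_le_compat_r; [|lra].
  apply Rmult_le_pos; [|apply pow_le; lra].
  apply Rmult_le_pos; [|left; apply Rinv_0_lt_compat; lra].
  apply Rmult_le_pos; lra. }
generalize (Hb (minus l (u n))) (norm_ge_0 (minus l (u n))); intros H3 H4.
assert (H5 : r * norm (minus l (u n)) <= 1 * norm (minus l (u n)))
  by (apply Rmult_le_compat_r; lra).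
lra.
Qed.

Section MiyaderaVoigt.
Context {X : CompleteNormedModule R_AbsRing}.
Context (A : operator X) (T : R -> X -> X) (D : X -> X).
Context (HT : C0_semigroup T) (HA : is_generator A T) (HD : is_linear_X1 A D).
Context (M q : R) (HM0 : 0 <= M) (Hq01 : 0 <= q < 1).
Context (HM : forall t x, 0 <= t -> norm (T t x) <= M * norm x).
Context (Hq : forall b x, 0 <= b -> op_dom A x ->
  RInt (fun s => norm (D (clamp T s x))) 0 b <= q * norm x).

Lemma clamp_family : sc_family (clamp T) M.
Proof.
split.
- intros t; apply (C0_linear _ HT), Rmax_l.
- intros t x; apply HM, Rmax_l.
- intros x t; apply C0_clamp_cont; auto.
Qed.

Lemma volterra_plus P Q c d x t :
  sc_family P c -> sc_family Q d -> op_dom A x ->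
  volterra T D (fun t x => plus (P t x) (Q t x)) x t =
  plus (volterra T D P x t) (volterra T D Q x t).
Proof.
intros HP HQ Hx; apply RInt_plus_cont; intros s.
- apply (volterra_integrand_cont A T D HT HA HD P c); auto.
- apply (volterra_integrand_cont A T D HT HA HD Q d); auto.
Qed.

Lemma volterra_minus P Q c d x t :
  sc_family P c -> sc_family Q d -> op_dom A x ->
  volterra T D (fun t x => minus (P t x) (Q t x)) x t =
  minus (volterra T D P x t) (volterra T D Q x t).
Proof.
intros HP HQ Hx; apply RInt_minus_cont; intros s.
- apply (volterra_integrand_cont A T D HT HA HD P c); auto.
- apply (volterra_integrand_cont A T D HT HA HD Q d); auto.
Qed.

(* [S] is the sum of the Dyson-Phillips series [sum_n V^n T]. *)
Lemma volterra_solution : exists S,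
  sc_family S (M / (1 - q)) /\
  (forall t x, norm (minus (S t x) (clamp T t x)) <= M * q / (1 - q) * norm x) /\
  forall t x, 0 <= t -> op_dom A x -> S t x = plus (T t x) (volterra T D S x t).
Proof.
(* The assumptions on the pair are premises inside the relation, so that [choice] gives a total map;
   the second component carries the operator bound. *)
assert (Hstep : forall p : (R -> X -> X) * R, exists Q,
  0 <= snd p -> sc_family (fst p) (snd p) -> sc_family Q (snd p * q) /\
  forall x t, 0 <= t -> op_dom A x -> Q t x = volterra T D (fst p) x t).
{ intros [P c]; simpl.
  destruct (classic (0 <= c /\ sc_family P c)) as [[Hc HP]|Hn].
  - destruct (volterra_family A T D HT HA HD q (proj1 Hq01) Hq P c Hc HP)
      as (Q & HQ); exists Q; auto.
  - exists P; intros; exfalso; auto. }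
destruct (choice _ Hstep) as [V HV].
set (term := fix term n := match n with
  | O => clamp T | S m => V (term m, M * q ^ m) end).
assert (Hpow : forall n, 0 <= M * q ^ n)
  by (intros n; apply Rmult_le_pos; auto; apply pow_le; lra).
assert (Hterm : forall n, sc_family (term n) (M * q ^ n)).
{ induction n as [|n IH].
  - simpl; rewrite Rmult_1_r; apply clamp_family.
  - simpl; rewrite (Rmult_comm q), <- Rmult_assoc.
    apply (HV (term n, M * q ^ n)); simpl; auto. }
assert (HtermV : forall n x t, 0 <= t -> op_dom A x ->
  term (S n) t x = volterra T D (term n) x t).
{ intros n; apply (HV (term n, M * q ^ n)); simpl; auto. }
set (sum := fix sum n := match n with
  | O => clamp T | S m => fun t x => plus (sum m t x) (term (S m) t x) end).
assert (Hsum : forall n, sc_family (sum n) (M * (1 - q ^ S n) / (1 - q))).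
{ induction n as [|n IH].
  - replace (M * (1 - q ^ 1) / (1 - q)) with M by (field; lra).
    apply clamp_family.
  - replace (M * (1 - q ^ S (S n)) / (1 - q))
      with (M * (1 - q ^ S n) / (1 - q) + M * q ^ S n) by (simpl; field; lra).
    apply sc_family_plus; auto. }
(* [sc_family_limit] needs one bound for all partial sums, namely the full geometric sum. *)
assert (HsumC : forall n, sc_family (sum n) (M / (1 - q))).
{ intros n; apply (sc_family_weaken _ _ _ (Hsum n)); intros t x.
  eapply Rle_trans; [apply (sc_bound _ _ (Hsum n))|].
  apply Rmult_le_compat_r; [apply norm_ge_0|].
  apply Rmult_le_compat_r; [left; apply Rinv_0_lt_compat; lra|].
  generalize (Hpow (S n)); lra. }
assert (HsumV : forall n x t, 0 <= t -> op_dom A x ->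
  sum (S n) t x = plus (T t x) (volterra T D (sum n) x t)).
{ induction n as [|n IH]; intros x t Ht Hx.
  - change (plus (clamp T t x) (term 1%nat t x)
            = plus (T t x) (volterra T D (clamp T) x t)).
    rewrite HtermV, clamp_pos by auto; reflexivity.
  - change (plus (sum (S n) t x) (term (S (S n)) t x)
            = plus (T t x) (volterra T D (sum (S n)) x t)).
    change (sum (S n)) with (fun t x => plus (sum n t x) (term (S n) t x)) at 2.
    rewrite (volterra_plus _ _ _ _ _ _ (HsumC n) (Hterm (S n))) by auto.
    rewrite IH, HtermV by auto; module_eq. }
destruct (sc_family_limit sum (M / (1 - q)) (M * q) q Hq01 HsumC)
  as (S' & HS' & Hlim).
{ intros n t x; rewrite Nat.add_1_r; simpl.
  replace (minus (plus (sum n t x) (V (term n, M * q ^ n) t x)) (sum n t x))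
    with (V (term n, M * q ^ n) t x) by module_eq.
  eapply Rle_trans; [apply (sc_bound _ _ (Hterm (S n)))|].
  right; simpl; ring. }
exists S'; split; [|split]; auto.
(* The tail estimate at [n = 0], where the partial sum is [T], shows that [S - T] is of order
   [q]. *)
- intros t x; eapply Rle_trans; [apply (Hlim O)|].
  right; simpl; field; lra.
- intros t x Ht Hx; apply norm_minus_eq; intros eps He.
  set (k := M * q * norm x / (1 - q)).
  destruct (pow_small q k (eps / 2) Hq01) as [n Hn]; [lra|].
  assert (Hk0 : 0 <= k).
  { apply Rmult_le_pos; [|left; apply Rinv_0_lt_compat; lra].
    apply Rmult_le_pos; [apply Rmult_le_pos; lra|apply norm_ge_0]. }
  assert (Hkn : 0 <= k * q ^ n)
    by (apply Rmult_le_pos; [auto|apply pow_le; lra]).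
  assert (Hqk : q * (k * q ^ n) <= 1 * (k * q ^ n))
    by (apply Rmult_le_compat_r; lra).
  eapply Rle_trans; [apply norm_minus_triangle with (y := sum (S n) t x)|].
  assert (H1 : norm (minus (S' t x) (sum (S n) t x)) <= eps / 2).
  { eapply Rle_trans; [apply Hlim|].
    replace (M * q * norm x * q ^ S n / (1 - q)) with (q * (k * q ^ n))
      by (unfold k; simpl; field; lra); lra. }
  assert (H2 : norm (minus (sum (S n) t x) (plus (T t x) (volterra T D S' x t)))
               <= eps / 2).
  { rewrite HsumV by auto.
    replace (minus (plus (T t x) (volterra T D (sum n) x t))
               (plus (T t x) (volterra T D S' x t)))
      with (minus (volterra T D (sum n) x t) (volterra T D S' x t)) by module_eq.
    rewrite <- (volterra_minus _ _ _ _ _ _ (HsumC n) HS') by auto.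
    eapply Rle_trans; [apply (volterra_le A T D HT HA HD q Hq _
      (M * q * q ^ n / (1 - q)))|]; auto.
    - apply Rmult_le_pos; [|left; apply Rinv_0_lt_compat; lra].
      apply Rmult_le_pos; [apply Rmult_le_pos; lra|apply pow_le; lra].
    - intros s; apply (continuous_minus (fun s => sum n (t - s) (D (clamp T s x)))
        (fun s => S' (t - s) (D (clamp T s x)))).
      + apply (volterra_integrand_cont A T D HT HA HD (sum n) (M / (1 - q))); auto.
      + apply (volterra_integrand_cont A T D HT HA HD S' (M / (1 - q))); auto.
    - intros s y _; rewrite norm_minus_sym.
      eapply Rle_trans; [apply Hlim|]; right; field; lra.
    - replace (M * q * q ^ n / (1 - q) * q * norm x) with (q * (k * q ^ n))
        by (unfold k; field; lra); lra. }
  lra.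
Qed.

Context (S : R -> X -> X) (C : R) (HC : 0 <= C) (HS : sc_family S C).
Context (HSV : forall t x, 0 <= t -> op_dom A x ->
  S t x = plus (T t x) (volterra T D S x t)).

Let integrand_cont := volterra_integrand_cont A T D HT HA HD.

(** Split the integral of the equation at time [t + s] at the point [s]. The part over [[s, t + s]]
    is, after a shift, the equation at time [t] for [T s x], leaving [S t (T s x)] and an integral
    over [[0, s]]. Subtracting [S t] applied to the equation at time [s] cancels [S t (T s x)]. *)
Lemma defect_volterra t s x : 0 <= t -> 0 <= s -> op_dom A x ->
  minus (S (t + s) x) (S t (S s x)) =
  volterra T D (fun s x => minus (S (t + s) x) (S t (S s x))) x s.
Proof.
intros Ht Hs Hx.
destruct (orbit_dom A T HT HA s x Hx) as [Hdom _].
rewrite clamp_pos in Hdom by auto.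
assert (Hc := fun r => integrand_cont S C x r).
assert (Hc1 : forall r, continuous (fun r => S (t + (s - r)) (D (clamp T r x))) r).
{ intros r; apply (continuous_ext (fun r => S (t + s - r) (D (clamp T r x)))).
  - intros u; f_equal; ring.
  - apply Hc; auto. }
assert (Hc2 : forall r, continuous (fun r => S t (S (s - r) (D (clamp T r x)))) r).
{ intros r; apply (sc_comp_cont S C (fun _ => t)
    (fun r => S (s - r) (D (clamp T r x)))); auto using continuous_const. }
unfold volterra.
rewrite RInt_minus_cont by auto.
rewrite (RInt_linear (S t)) by (apply (sc_linear _ _ HS) || (intros; apply Hc; auto)).
fold (volterra T D S x s).
assert (E1 : S (t + s) x = plus (S t (T s x))
  (RInt (fun r => S (t + (s - r)) (D (clamp T r x))) 0 s)).
{ rewrite (HSV (t + s)), (HSV t (T s x)) by (auto; lra).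
  unfold volterra.
  rewrite (RInt_Chasles_cont _ 0 s (t + s)) by (intros; apply Hc; auto).
  rewrite (C0_add _ HT) by auto.
  assert (E2 : RInt (fun r => S (t + s - r) (D (clamp T r x))) s (t + s) =
     RInt (fun r => S (t - r) (D (clamp T r (T s x)))) 0 t).
  { transitivity (RInt (fun r => S (t + s - (r + s)) (D (clamp T (r + s) x))) 0 t).
    - rewrite (RInt_shift (fun r => S (t + s - r) (D (clamp T r x))) 0 t s)
        by (intros; apply Hc; auto).
      rewrite Rplus_0_l; reflexivity.
    - apply RInt_ext; intros r; rewrite Rmin_left, Rmax_right by auto; intros Hr.
      rewrite !clamp_pos, (C0_add _ HT) by lra.
      f_equal; ring. }
  rewrite E2.
  replace (RInt (fun r => S (t + s - r) (D (clamp T r x))) 0 s)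
    with (RInt (fun r => S (t + (s - r)) (D (clamp T r x))) 0 s).
  - module_eq.
  - apply RInt_ext; intros r _; f_equal; ring. }
rewrite E1, (HSV s x) by auto.
rewrite (lin_plus (S t)) by apply (sc_linear _ _ HS); module_eq.
Qed.

Lemma volterra_semigroup : C0_semigroup S.
Proof.
assert (HdA := op_dom_dense A T HT HA).
assert (H0 : forall x, S 0 x = x).
{ apply (dense_linear_eq (op_dom A)); auto.
  - apply (sc_linear _ _ HS).
  - apply (is_linear_intro _ 1); auto; intros; lra.
  - intros x Hx; rewrite HSV, (C0_zero _ HT) by (auto; lra).
    unfold volterra; rewrite RInt_point_0; module_eq. }
split; auto.
- intros t _; apply (sc_linear _ _ HS).
- intros t s x Ht Hs.
  set (K := C + C * C).
  assert (HK : 0 <= K) by (generalize (Rmult_le_pos C C HC HC); unfold K; lra).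
  assert (HL : forall r, is_linear (fun x => minus (S (t + r) x) (S t (S r x)))).
  { intros r; apply (is_linear_intro _ K).
    - intros y z; rewrite (lin_plus (S (t + r))), (lin_plus (S r)),
        (lin_plus (S t)) by apply (sc_linear _ _ HS); module_eq.
    - intros k y; rewrite (lin_scal (S (t + r))), (lin_scal (S r)),
        (lin_scal (S t)) by apply (sc_linear _ _ HS); module_eq.
    - intros y; eapply Rle_trans; [apply norm_minus_le|].
      unfold K; rewrite Rmult_plus_distr_r; apply Rplus_le_compat;
        [apply (sc_bound _ _ HS)|].
      eapply Rle_trans; [apply (sc_bound _ _ HS)|]; rewrite Rmult_assoc.
      apply Rmult_le_compat_l; auto; apply (sc_bound _ _ HS). }
  (* Each passage through [V] gains a factor [q]. The statement covers all times [r] because [V]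
     evaluates the defect at all earlier times. *)
  assert (Hn : forall n r y, 0 <= r ->
    norm (minus (S (t + r) y) (S t (S r y))) <= K * q ^ n * norm y).
  { induction n as [|n IH]; intros r y Hr.
    - simpl; rewrite Rmult_1_r; eapply Rle_trans; [apply norm_minus_le|].
      unfold K; rewrite Rmult_plus_distr_r; apply Rplus_le_compat;
        [apply (sc_bound _ _ HS)|].
      eapply Rle_trans; [apply (sc_bound _ _ HS)|]; rewrite Rmult_assoc.
      apply Rmult_le_compat_l; auto; apply (sc_bound _ _ HS).
    - assert (Hpow : forall m, 0 <= K * q ^ m)
        by (intros; apply Rmult_le_pos; auto; apply pow_le; lra).
      (* The bound must be extended from [dom A] to all of [X] before the next passage, since
         [D (T u y)] need not lie in [dom A]. *)
      revert y; apply (dense_norm_le (op_dom A)); auto.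
      intros y Hy; rewrite defect_volterra by auto.
      replace (K * q ^ Datatypes.S n) with (K * q ^ n * q) by (simpl; ring).
      apply (volterra_le A T D HT HA HD q Hq); auto.
      intros u; apply (continuous_minus
        (fun u => S (t + (r - u)) (D (clamp T u y)))
        (fun u => S t (S (r - u) (D (clamp T u y))))).
      + apply (continuous_ext (fun u => S (t + r - u) (D (clamp T u y)))).
        * intros v; f_equal; ring.
        * apply (integrand_cont S C); auto.
      + apply (sc_comp_cont S C (fun _ => t)
          (fun u => S (r - u) (D (clamp T u y)))); auto using continuous_const.
        apply (integrand_cont S C); auto. }
  apply norm_minus_eq; intros eps He.
  destruct (pow_small q (K * norm x) eps Hq01 He) as [n HnK].
  eapply Rle_trans; [apply (Hn n s x Hs)|].
  replace (K * q ^ n * norm x) with (K * norm x * q ^ n) by ring; lra.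
- intros x; apply filterlim_right_norm; intros eps He.
  destruct (proj1 (continuous_norm_iff _ _) (sc_cont _ _ HS x 0) eps He)
    as (d & Hd & Hd').
  exists d; split; auto; intros h Hh; rewrite H0 in Hd'; apply Hd'.
  rewrite Rabs_right; lra.
Qed.

(** [V S x h = h k(h)] with [k] continuous and [k 0 = D x], the latter because [S 0] is the
    identity; hence the integral term contributes [D x] to the derivative at 0. *)
Lemma volterra_generates x : op_dom A x ->
  generates S x (plus (op_app A x) (D x)).
Proof.
intros Hx; apply generates_iff; intros eps He.
set (k := fun t => RInt (fun s => S (t - t * s) (D (clamp T (t * s) x))) 0 1).
assert (Hk0 : k 0 = D x).
{ unfold k; transitivity (RInt (fun _ => D x) 0 1).
  - apply RInt_ext; intros s _.
    rewrite Rmult_0_l, Rminus_0_r, (clamp_pos T 0), (C0_zero _ HT) by lra.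
    apply (C0_zero _ volterra_semigroup).
  - etransitivity; [exact (RInt_const 0 1 (D x))|].
    change (scal (1 - 0) (D x) = D x); module_eq. }
destruct (proj1 (continuous_norm_iff _ _)
  (volterra_kernel_cont A T D HT HA HD S C x 0 HS Hx) (eps / 2))
  as (d & Hd & Hd'); [lra|]; fold k in Hd'.
destruct (proj1 (generates_iff _ _ _) (op_generates A T HA x Hx) (eps / 2))
  as (e & Hpos & He'); [lra|].
exists (Rmin d e); split; [apply Rmin_pos; auto|]; intros h Hh.
specialize (He' h ltac:(generalize (Rmin_r d e); lra)).
assert (H1 : norm (minus (k h) (D x)) < eps / 2).
{ rewrite <- Hk0; apply Hd'; rewrite Rabs_right;
    generalize (Rmin_l d e); lra. }
rewrite HSV by (auto; lra).
rewrite (volterra_unit A T D HT HA HD S C) by auto.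
change (RInt (fun s => S (h - h * s) (D (clamp T (h * s) x))) 0 1) with (k h).
replace (minus (scal (/ h) (minus (plus (T h x) (scal h (k h))) x))
    (plus (op_app A x) (D x)))
  with (plus (minus (scal (/ h) (minus (T h x) x)) (op_app A x))
             (minus (k h) (D x))) by (module_eq; lra).
eapply Rle_lt_trans; [apply norm_plus_le|lra].
Qed.

(* With [K x = int_0^1 T(s) x ds] one has [- (A + D) K = I - E] where
   [E = T(1) + D K], so no resolvent of [A] is needed. *)
Lemma perturbed_generator_onto m z :
  (forall x, norm (T 1 x) <= m * norm x) -> 0 <= m -> q + m < 1 ->
  exists x, op_dom A x /\ opp (plus (op_app A x) (D x)) = z.
Proof.
intros Hm Hm0 Hqm.
set (K := fun x => RInt (fun s => clamp T s x) 0 1).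
assert (Hcont : forall x t, continuous (fun s => clamp T s x) t)
  by (intros; apply C0_clamp_cont; auto).
assert (HLT : forall s, is_linear (clamp T s))
  by (intros; apply (C0_linear _ HT), Rmax_l).
assert (HLT1 : is_linear (T 1)) by (apply (C0_linear _ HT); lra).
assert (HK : forall x, op_dom A (K x) /\ op_app A (K x) = minus (T 1 x) x).
{ intros x; apply (generates_op A T HA), generates_RInt; auto; lra. }
assert (HKp : forall x y, K (plus x y) = plus (K x) (K y)).
{ intros x y; unfold K; rewrite <- RInt_plus_cont by auto.
  apply RInt_ext; intros s _; apply lin_plus; auto. }
assert (HKs : forall r x, K (scal r x) = scal r (K x)).
{ intros r x; unfold K; rewrite <- RInt_scal_cont by auto.
  apply RInt_ext; intros s _; apply lin_scal; auto. }
assert (HDL := perturbation_linear_on A D HD).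
destruct (X1_norm _ _ HD) as (Md & HMd & HDb).
(* A crude constant, from the graph norm of [K x] with [A (K x) = T 1 x - x]. Its purpose is to
   permit the density argument that gives the sharp constant [q] next. *)
assert (HDK : is_linear (fun x => D (K x))).
{ apply (is_linear_intro _ (Md * (M + (m + 1)))).
  - intros x y; rewrite HKp; apply HDL; apply HK.
  - intros r x; rewrite HKs; apply HDL; apply HK.
  - intros x; eapply Rle_trans; [apply HDb, HK|].
    rewrite Rmult_assoc; apply Rmult_le_compat_l; [lra|].
    unfold graph_norm; rewrite (proj2 (HK x)), !Rmult_plus_distr_r.
    apply Rplus_le_compat.
    + replace (M * norm x) with ((1 - 0) * (M * norm x)) by ring.
      apply RInt_norm_le_const; auto; [lra|].
      intros t _; apply HM, Rmax_l.
    + rewrite Rmult_1_l; eapply Rle_trans; [apply norm_minus_le|].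
      apply Rplus_le_compat_r; auto. }
(* On [dom A], [D (K x)] is the integral of [D (T s x)] over [[0, 1]], which the smallness condition
   bounds. *)
assert (HDKq : forall x, norm (D (K x)) <= q * norm x).
{ apply (dense_norm_le (op_dom A)); auto; [apply (op_dom_dense A T); auto|lra|].
  intros x Hx; unfold K.
  rewrite <- (perturbation_RInt A T D) by (auto; lra).
  eapply Rle_trans; [|apply (Hq 1); auto; lra].
  assert (Hg : forall t, continuous (fun s => D (clamp T s x)) t)
    by (intros; apply (perturbed_orbit_cont A T D); auto).
  apply RInt_norm_le; auto; [lra| |].
  - intros t; apply continuous_norm_comp; auto.
  - intros; apply Rle_refl. }
destruct (neumann (fun x => plus (T 1 x) (D (K x))) (q + m) z) as [x Hx].
- apply (is_linear_intro _ (q + m)).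
  + intros x y; rewrite (lin_plus (T 1)), (lin_plus (fun x => D (K x))) by auto.
    module_eq.
  + intros r x; rewrite (lin_scal (T 1)), (lin_scal (fun x => D (K x))) by auto.
    module_eq.
  + intros x; eapply Rle_trans; [apply norm_plus_le|].
    generalize (Hm x) (HDKq x); lra.
- lra.
- intros x; eapply Rle_trans; [apply norm_plus_le|].
  generalize (Hm x) (HDKq x); lra.
- exists (K x); split; [apply HK|].
  rewrite (proj2 (HK x)), <- Hx; module_eq.
Qed.

End MiyaderaVoigt.

(** * Rescaling of generators and of their perturbations *)

Lemma exp_nondecreasing u v : u <= v -> exp u <= exp v.
Proof.
intros [Huv | ->]; [left; apply exp_increasing; auto|apply Rle_refl].
Qed.

Lemma exp_le_1 u : u <= 0 -> exp u <= 1.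
Proof. intros Hu; rewrite <- exp_0; apply exp_nondecreasing; auto. Qed.

Lemma exp_small eps : 0 < eps -> exists lambda, 0 <= lambda /\ exp (- lambda) <= eps.
Proof.
intros He; assert (Hi : 0 < / eps) by (apply Rinv_0_lt_compat; auto).
exists (/ eps); split; [lra|].
rewrite exp_Ropp; apply Rle_trans with (/ / eps); [|rewrite Rinv_inv; lra].
apply Rinv_le_contravar; auto.
generalize (exp_ineq1_le (/ eps)); lra.
Qed.

Definition shift_op {X : CompleteNormedModule R_AbsRing} (mu : R)
    (A : operator X) : operator X :=
  Operator (op_dom A) (fun x => plus (op_app A x) (scal mu x)).

Lemma generates_ext {X : CompleteNormedModule R_AbsRing} (T T' : R -> X -> X) x y :
  (forall t, T t x = T' t x) -> generates T x y -> generates T' x y.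
Proof.
intros H; unfold generates; apply filterlim_ext; intros h; rewrite H; auto.
Qed.

(** The converse inclusion is the direct one for [- mu], since the two rescalings are inverse to
    each other. *)
Lemma shift_op_generator {X : CompleteNormedModule R_AbsRing} (mu : R)
    (A : operator X) (T : R -> X -> X) :
  is_generator A T -> is_generator (shift_op mu A) (rescale mu T).
Proof.
intros HA x y; split.
- intros [Hx <-]; apply rescale_generates, (op_generates A T HA x Hx).
- intros H; apply (rescale_generates (- mu)) in H.
  apply (generates_ext _ T) in H.
  + destruct (generates_op A T HA _ _ H) as [Hx E]; split; [exact Hx|].
    simpl; rewrite E; module_eq.
  + intros t; unfold rescale.
    transitivity (scal (exp (- mu * t) * exp (mu * t)) (T t x)); [module_eq|].
    rewrite <- exp_plus.
    replace (- mu * t + mu * t) with 0 by ring; rewrite exp_0; module_eq.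
Qed.

(** The graph norms of [A] and [A + mu] are equivalent. *)
Lemma shift_op_linear_X1 {X : CompleteNormedModule R_AbsRing} (mu : R)
    (A : operator X) (D : X -> X) :
  is_linear_X1 A D -> is_linear_X1 (shift_op mu A) D.
Proof.
intros [H1 H2 (M & HM & Hb)]; split; [exact H1|exact H2|].
assert (Hmu := Rabs_pos mu).
exists (M * (1 + Rabs mu)); split; [apply Rmult_lt_0_compat; lra|].
intros x Hx; eapply Rle_trans; [apply Hb, Hx|].
rewrite Rmult_assoc; apply Rmult_le_compat_l; [lra|].
unfold graph_norm; simpl.
change (norm x + norm (op_app A x) <=
  (1 + Rabs mu) * (norm x + norm (plus (op_app A x) (scal mu x)))).
set (w := plus (op_app A x) (scal mu x)).
replace (op_app A x) with (minus w (scal mu x)) by (unfold w; module_eq).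
generalize (norm_minus_le w (scal mu x)) (norm_scal_le mu x) (norm_ge_0 w).
intros H3 H4 H5.
assert (H6 : 0 <= Rabs mu * norm w) by (apply Rmult_le_pos; auto).
lra.
Qed.

Lemma rescale_orbit_norm {X : CompleteNormedModule R_AbsRing} (mu : R)
    (A : operator X) (T : R -> X -> X) (D : X -> X) s x :
  C0_semigroup T -> is_generator A T -> is_linear_X1 A D -> mu <= 0 ->
  op_dom A x ->
  norm (D (clamp (rescale mu T) s x)) <= norm (D (clamp T s x)).
Proof.
intros HT HA HD Hmu Hx.
change (clamp (rescale mu T) s x)
  with (scal (exp (mu * Rmax 0 s)) (clamp T s x)).
rewrite (proj2 (perturbation_linear_on A D HD))
  by (apply (orbit_dom A T HT HA); auto).
eapply Rle_trans; [apply norm_scal_le|].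
rewrite Rabs_right by (left; apply exp_pos).
rewrite <- (Rmult_1_l (norm (D (clamp T s x)))) at 2.
apply Rmult_le_compat_r; [apply norm_ge_0|apply exp_le_1].
generalize (Rmult_le_compat_neg_l mu 0 (Rmax 0 s) Hmu (Rmax_l 0 s)); lra.
Qed.

Lemma rescale_orbit_RInt {X : CompleteNormedModule R_AbsRing} (mu : R)
    (A : operator X) (T : R -> X -> X) (D : X -> X) b x :
  C0_semigroup T -> is_generator A T -> is_linear_X1 A D -> mu <= 0 ->
  op_dom A x -> 0 <= b ->
  RInt (fun s => norm (D (clamp (rescale mu T) s x))) 0 b <=
  RInt (fun s => norm (D (clamp T s x))) 0 b.
Proof.
intros HT HA HD Hmu Hx Hb; apply RInt_le; auto.
- apply (ex_RInt_cont (X := R_CompleteNormedModule)); intros t.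
  apply continuous_norm_comp, (perturbed_orbit_cont (shift_op mu A));
    auto using rescale_C0, shift_op_generator, shift_op_linear_X1.
- apply (ex_RInt_cont (X := R_CompleteNormedModule)); intros t.
  apply continuous_norm_comp, (perturbed_orbit_cont A); auto.
- intros s _; apply (rescale_orbit_norm mu A); auto.
Qed.

(** * The Miyadera-Voigt theorem *)

(** Injectivity of [lambda] minus the generator: after rescaling by [- lambda], [w] has derivative
    zero, so it is fixed by the rescaled semigroup at time 1, which shrinks its norm by a factor
    below 1 unless [w] is zero. *)
Lemma eigenvector_zero {X : CompleteNormedModule R_AbsRing} (S : R -> X -> X)
    (lambda C : R) (w : X) :
  C0_semigroup S -> norm (S 1 w) <= C * norm w -> exp (- lambda) * C < 1 ->
  generates S w (scal lambda w) -> w = zero.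
Proof.
intros HS HC HlC H.
apply (rescale_generates (- lambda)) in H.
replace (plus (scal lambda w) (scal (- lambda) w)) with (zero : X) in H
  by module_eq.
assert (HR := rescale_C0 (- lambda) S HS).
assert (E := generates_FTC _ 1 w zero HR (Rlt_le _ _ Rlt_0_1) H).
assert (E0 : RInt (fun s => clamp (rescale (- lambda) S) s (zero : X)) 0 1 = zero).
{ transitivity (RInt (fun _ => zero : X) 0 1).
  - apply RInt_ext; intros s _.
    assert (HL : is_linear (clamp (rescale (- lambda) S) s))
      by (apply (C0_linear _ HR), Rmax_l).
    replace (zero : X) with (scal 0 (zero : X)) at 1 by module_eq.
    rewrite (lin_scal _ 0 _ HL); module_eq.
  - etransitivity; [exact (RInt_const 0 1 (zero : X))|].
    change (scal (1 - 0) (zero : X) = zero); module_eq. }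
rewrite E0 in E; clear E0.
assert (Ew : rescale (- lambda) S 1 w = w).
{ replace (rescale (- lambda) S 1 w)
    with (plus (minus (rescale (- lambda) S 1 w) w) w) by module_eq.
  rewrite <- E; module_eq. }
unfold rescale in Ew; rewrite Rmult_1_r in Ew.
assert (Hn : norm w <= exp (- lambda) * (C * norm w)).
{ rewrite <- Ew at 1; eapply Rle_trans; [apply norm_scal_le|].
  rewrite Rabs_right by (left; apply exp_pos).
  apply Rmult_le_compat_l; auto; left; apply exp_pos. }
assert (H0 : norm w = 0).
{ generalize (norm_ge_0 w); intros Hw.
  destruct (Req_dec (norm w) 0); auto; exfalso.
  assert (H1 : exp (- lambda) * C * norm w < 1 * norm w)
    by (apply Rmult_lt_compat_r; lra).
  lra. }
exact (norm_eq_zero w H0).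
Qed.

(** The global case, with a bounded semigroup and a smallness condition on every interval. It
    remains to show that the generator [G] of the fixed point [S] has no domain beyond [dom A]:
    given [G x = y], a solution [x'] of [(lambda - A - D) x' = lambda x - y] in [dom A] must equal
    [x]. *)
Lemma miyadera_voigt_bounded {X : CompleteNormedModule R_AbsRing}
    (A : operator X) (T : R -> X -> X) (D : X -> X) (M q : R) :
  C0_semigroup T -> is_generator A T -> is_linear_X1 A D ->
  0 <= M -> 0 <= q < 1 ->
  (forall t x, 0 <= t -> norm (T t x) <= M * norm x) ->
  (forall b x, 0 <= b -> op_dom A x ->
     RInt (fun s => norm (D (clamp T s x))) 0 b <= q * norm x) ->
  exists S, C0_semigroup S /\ is_generator (perturb A D) S /\
    forall t x, 0 <= t ->
      norm (minus (S t x) (T t x)) <= M * q / (1 - q) * norm x.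
Proof.
intros HT HA HD HM0 Hq01 HM Hq.
destruct (volterra_solution A T D HT HA HD M q HM0 Hq01 HM Hq)
  as (S & HS & HST & HSV).
set (C := M / (1 - q)) in *.
assert (HC : 0 <= C)
  by (apply Rmult_le_pos; [|left; apply Rinv_0_lt_compat]; lra).
assert (HC0 := volterra_semigroup A T D HT HA HD q Hq01 Hq S C HC HS HSV).
assert (Hgen := volterra_generates A T D HT HA HD q Hq01 Hq S C HC HS HSV).
exists S; split; [|split]; auto.
2: { intros t x Ht; generalize (HST t x); rewrite clamp_pos; auto. }
intros x y; split.
{ intros [Hx <-]; apply Hgen; exact Hx. }
intros Hxy.
(* The part [exp (- lambda) * M <= (1 - q) / 2] serves surjectivity, which needs [q + m < 1]; the
   part with [C] serves injectivity, which needs [exp (- lambda) * C < 1]. *)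
destruct (exp_small ((1 - q) / (2 * (M + C + 1)))) as (lambda & Hl & Hexp).
{ apply Rdiv_lt_0_compat; lra. }
assert (Hpos := exp_pos (- lambda)).
assert (HlMC : exp (- lambda) * (M + C) <= (1 - q) / 2).
{ apply Rle_trans with ((1 - q) / (2 * (M + C + 1)) * (M + C + 1)).
  - apply Rmult_le_compat; lra.
  - right; field; lra. }
assert (HlM : 0 <= exp (- lambda) * M) by (apply Rmult_le_pos; lra).
assert (HlC : 0 <= exp (- lambda) * C) by (apply Rmult_le_pos; lra).
assert (HTb : forall t x, 0 <= t ->
  norm (rescale (- lambda) T t x) <= exp (- lambda * t) * M * norm x).
{ intros t w Ht; unfold rescale; eapply Rle_trans; [apply norm_scal_le|].
  rewrite Rabs_right, Rmult_assoc by (left; apply exp_pos).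
  apply Rmult_le_compat_l; [left; apply exp_pos|auto]. }
(* Applied to [A - lambda] and the correspondingly rescaled semigroup, surjectivity provides
   [x']. *)
destruct (perturbed_generator_onto (shift_op (- lambda) A)
  (rescale (- lambda) T) D (rescale_C0 _ _ HT) (shift_op_generator _ _ _ HA)
  (shift_op_linear_X1 _ _ _ HD) M q Hq01) with
  (m := exp (- lambda) * M) (z := minus (scal lambda x) y) as (x' & Hx' & E).
- intros t w Ht; eapply Rle_trans; [apply HTb; auto|].
  apply Rmult_le_compat_r; [apply norm_ge_0|].
  rewrite <- (Rmult_1_l M) at 2; apply Rmult_le_compat_r; auto.
  apply exp_le_1.
  generalize (Rmult_le_pos lambda t Hl Ht); lra.
- intros b w Hb Hw; eapply Rle_trans; [|apply (Hq b w Hb Hw)].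
  apply (rescale_orbit_RInt _ A); auto; lra.
- intros w; generalize (HTb 1 w Rle_0_1); rewrite Rmult_1_r; auto.
- lra.
- lra.
- simpl in Hx', E.
  change (opp (plus (plus (op_app A x') (scal (- lambda) x')) (D x'))
          = minus (scal lambda x) y) in E.
  assert (E1 : plus (op_app A x') (D x') =
    minus (scal lambda x') (minus (scal lambda x) y)) by (rewrite <- E; module_eq).
  (* [G] extends [A + D], so [x - x'] satisfies the eigenvector equation for [lambda]. *)
  assert (Hw : minus x x' = zero).
  { apply (eigenvector_zero S lambda C); auto.
    - apply (sc_bound _ _ HS).
    - lra.
    - replace (minus x x') with (plus x (scal (- (1)) x')) by module_eq.
      replace (scal lambda (plus x (scal (- (1)) x')))
        with (plus y (scal (- (1)) (plus (op_app A x') (D x'))))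
        by (rewrite E1; module_eq).
      apply generates_plus; auto.
      apply generates_scal; auto. }
  assert (Ex : x = x').
  { replace x with (plus (minus x x') x') by module_eq.
    rewrite Hw; module_eq. }
  subst x'; split; [exact Hx'|].
  change (plus (op_app A x) (D x) = y); rewrite E1; module_eq.
Qed.

Lemma is_generator_ext {X : CompleteNormedModule R_AbsRing} (A B : operator X)
    (T : R -> X -> X) :
  (forall x, op_dom A x <-> op_dom B x) ->
  (forall x, op_dom A x -> op_app A x = op_app B x) ->
  is_generator A T -> is_generator B T.
Proof.
intros Hd Ha H x y; rewrite <- (H x y), <- (Hd x).
split; intros [Hx E]; split; auto; [rewrite Ha|rewrite <- Ha]; auto.
Qed.

(** [lambda] and [M] are produced before [D], which makes a uniform choice of [q] possible. The
    rescaling by [- lambda] reduces the local condition on [[0, t0]] to the global case. *)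
Lemma miyadera_voigt {X : CompleteNormedModule R_AbsRing} (A : operator X)
    (T : R -> X -> X) (t0 : R) :
  C0_semigroup T -> is_generator A T -> 0 < t0 ->
  exists lambda M, 0 <= lambda /\ 1 <= M /\
    forall (D : X -> X) q, is_linear_X1 A D -> 0 <= q <= 1 / 4 ->
      (forall x, op_dom A x ->
         RInt (fun s => norm (D (T s x))) 0 t0 <= q * norm x) ->
      exists S, C0_semigroup S /\ is_generator (perturb A D) S /\
        forall t x, 0 <= t ->
          norm (minus (S t x) (T t x)) <= exp (lambda * t) * (4 * M * q) * norm x.
Proof.
intros HT HA Ht0.
destruct (C0_bounded T t0 HT) as (M & HM1 & HM).
(* Then [exp (- lambda * t0) * M <= 1 / 2], so the rescaled semigroup halves norms over a time
   [t0]. *)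
destruct (exp_small (/ (2 * M))) as (l & Hl & Hexp).
{ apply Rinv_0_lt_compat; lra. }
set (lambda := l / t0).
assert (Hlt0 : - lambda * t0 = - l) by (unfold lambda; field; lra).
assert (Hlambda : 0 <= lambda)
  by (apply Rmult_le_pos; [|left; apply Rinv_0_lt_compat]; auto).
exists lambda, M; split; [|split]; auto.
intros D q HD Hq01 Hq.
set (T1 := rescale (- lambda) T); set (A1 := shift_op (- lambda) A).
assert (HT1 : C0_semigroup T1) by (apply rescale_C0; auto).
assert (HA1 : is_generator A1 T1) by (apply shift_op_generator; auto).
assert (HD1 : is_linear_X1 A1 D) by (apply shift_op_linear_X1; auto).
assert (Hhalf : forall x, norm (T1 t0 x) <= / 2 * norm x).
{ intros x; unfold T1, rescale; rewrite Hlt0.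
  eapply Rle_trans; [apply norm_scal_le|].
  rewrite Rabs_right by (left; apply exp_pos).
  apply Rle_trans with (/ (2 * M) * (M * norm x)).
  - apply Rmult_le_compat; auto.
    + left; apply exp_pos.
    + apply norm_ge_0.
    + apply HM; lra.
  - right; field; lra. }
assert (Hcover : forall t, exists n, t <= INR n * t0).
{ intros t; destruct (INR_unbounded (t / t0)) as [n Hn]; exists n.
  replace t with (t / t0 * t0) by (field; lra).
  apply Rmult_le_compat_r; lra. }
assert (HMT : forall t x, 0 <= t -> norm (T1 t x) <= M * norm x).
{ intros t x Ht; destruct (Hcover t) as [n Hn].
  revert t x Ht Hn.
  assert (Hsmall : forall t x, 0 <= t <= t0 -> norm (T1 t x) <= M * norm x).
  { intros t x Ht; unfold T1, rescale; eapply Rle_trans; [apply norm_scal_le|].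
    rewrite Rabs_right by (left; apply exp_pos).
    rewrite <- (Rmult_1_l (M * norm x)).
    apply Rmult_le_compat; auto using norm_ge_0.
    - left; apply exp_pos.
    - apply exp_le_1; generalize (Rmult_le_pos lambda t Hlambda (proj1 Ht)); lra. }
  induction n as [|n IH]; intros t x Ht Hn.
  - simpl in Hn; apply Hsmall; lra.
  - destruct (Rle_dec t t0) as [Hle|Hgt]; [apply Hsmall; lra|].
    rewrite S_INR in Hn.
    replace t with ((t - t0) + t0) by ring.
    rewrite (C0_add _ HT1) by lra.
    eapply Rle_trans; [apply IH; lra|].
    apply Rmult_le_compat_l; [lra|].
    generalize (Hhalf x) (norm_ge_0 x); lra. }
assert (Hcont : forall x t, op_dom A x ->
  continuous (fun s => norm (D (clamp T1 s x))) t).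
{ intros x t Hx; apply continuous_norm_comp, (perturbed_orbit_cont A1); auto. }
assert (Hex : forall x a b, op_dom A x ->
  ex_RInt (fun s => norm (D (clamp T1 s x))) a b).
{ intros x a b Hx; apply (ex_RInt_cont (X := R_CompleteNormedModule)); auto. }
assert (Hq1 : forall x, op_dom A x ->
  RInt (fun s => norm (D (clamp T1 s x))) 0 t0 <= q * norm x).
{ intros x Hx.
  eapply Rle_trans; [apply (rescale_orbit_RInt _ A); auto; lra|].
  rewrite <- (RInt_ext (V := R_CompleteNormedModule) (fun s => norm (D (T s x)))).
  - apply Hq; auto.
  - intros s; rewrite Rmin_left, Rmax_right by lra; intros Hs.
    rewrite clamp_pos; auto; lra. }
(* Past [t0] the integral runs along the orbit of [T1 t0 x], whose norm is at most half that of [x]: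
   the constant 2 reproduces itself, as [q + 2 q / 2 = 2 q]. *)
assert (Hqb : forall b x, 0 <= b -> op_dom A x ->
  RInt (fun s => norm (D (clamp T1 s x))) 0 b <= 2 * q * norm x).
{ intros b x Hb Hx; destruct (Hcover b) as [n Hn].
  revert b x Hb Hx Hn.
  assert (Hsplit : forall b c x, op_dom A x ->
    RInt (fun s => norm (D (clamp T1 s x))) 0 c =
    RInt (fun s => norm (D (clamp T1 s x))) 0 b +
    RInt (fun s => norm (D (clamp T1 s x))) b c).
  { intros b c x Hx; exact (RInt_Chasles_cont (X := R_CompleteNormedModule)
      _ 0 b c (fun t => Hcont x t Hx)). }
  induction n as [|n IH]; intros b x Hb Hx Hn.
  - simpl in Hn; replace b with 0 by lra.
    assert (E : RInt (fun s => norm (D (clamp T1 s x))) 0 0 = 0)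
      by exact (RInt_point 0 _).
    rewrite E; generalize (norm_ge_0 x); intros.
    apply Rmult_le_pos; lra.
  - rewrite S_INR in Hn.
    assert (Hqx : 0 <= q * norm x) by (apply Rmult_le_pos; [lra|apply norm_ge_0]).
    destruct (Rle_dec b t0) as [Hle|Hgt].
    + apply Rle_trans with (q * norm x); [|lra].
      eapply Rle_trans; [|apply Hq1; auto].
      rewrite (Hsplit b t0) by auto.
      assert (H : 0 <= RInt (fun s => norm (D (clamp T1 s x))) b t0).
      { apply RInt_ge_0; auto; intros; apply norm_ge_0. }
      lra.
    + rewrite (Hsplit t0 b) by auto.
      assert (E : RInt (fun s => norm (D (clamp T1 s x))) t0 b =
                  RInt (fun s => norm (D (clamp T1 s (T1 t0 x)))) 0 (b - t0)).
      { transitivity (RInt (fun s => norm (D (clamp T1 (s + t0) x))) 0 (b - t0)).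
        - rewrite (RInt_shift (X := R_CompleteNormedModule)
            (fun s => norm (D (clamp T1 s x)))) by auto.
          rewrite Rplus_0_l; f_equal; ring.
        - apply (RInt_ext (V := R_CompleteNormedModule)); intros s.
          rewrite Rmin_left, Rmax_right by lra; intros Hs.
          rewrite !clamp_pos, (C0_add _ HT1) by lra; reflexivity. }
      rewrite E.
      assert (H1 := IH (b - t0) (T1 t0 x) ltac:(lra)).
      assert (Hdom : op_dom A (T1 t0 x)).
      { generalize (proj1 (orbit_dom A1 T1 HT1 HA1 t0 x Hx)).
        rewrite clamp_pos by lra; auto. }
      specialize (H1 Hdom ltac:(lra)).
      assert (H2 : 2 * q * norm (T1 t0 x) <= 2 * q * (/ 2 * norm x))
        by (apply Rmult_le_compat_l; auto; lra).
      generalize (Hq1 x Hx); lra. }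
destruct (miyadera_voigt_bounded A1 T1 D M (2 * q) HT1 HA1 HD1)
  as (S1 & HS1 & HG1 & Hd1); auto; try lra.
exists (rescale lambda S1); split; [apply rescale_C0; auto|split].
- apply (is_generator_ext (shift_op lambda (perturb A1 D)));
    [| |apply shift_op_generator; auto].
  + intros x; apply iff_refl.
  + intros x _.
    change (plus (plus (plus (op_app A x) (scal (- lambda) x)) (D x))
      (scal lambda x) = plus (op_app A x) (D x)); module_eq.
- intros t x Ht.
  replace (T t x) with (rescale lambda T1 t x).
  + unfold rescale.
    replace (minus (scal (exp (lambda * t)) (S1 t x)) (scal (exp (lambda * t)) (T1 t x)))
      with (scal (exp (lambda * t)) (minus (S1 t x) (T1 t x))) by module_eq.
    eapply Rle_trans; [apply norm_scal_le|].
    rewrite Rabs_right by (left; apply exp_pos); rewrite !Rmult_assoc.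
    apply Rmult_le_compat_l; [left; apply exp_pos|].
    eapply Rle_trans; [apply Hd1; auto|].
    (* Here [q <= 1 / 4] enters: [/ (1 - 2 * q) <= 2], hence the constant [4 * M * q]. *)
    replace (4 * (M * (q * norm x))) with (M * (2 * q) * 2 * norm x) by ring.
    apply Rmult_le_compat_r; [apply norm_ge_0|].
    apply Rmult_le_compat_l; [apply Rmult_le_pos; lra|].
    rewrite <- (Rinv_inv 2); apply Rinv_le_contravar; lra.
  + unfold T1, rescale.
    transitivity (scal (exp (lambda * t) * exp (- lambda * t)) (T t x)); [module_eq|].
    rewrite <- exp_plus.
    replace (lambda * t + - lambda * t) with 0 by ring; rewrite exp_0; module_eq.
Qed.

(** * Sampled-data systems *)

(** The state a time [t] into a sampling period that starts at [x], with the input frozen; at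
    [t = tau] it is the one-period operator. *)
Definition hold {X : CompleteNormedModule R_AbsRing} (S : R -> X -> X)
    (B : X -> X) (t : R) (x : X) : X :=
  plus (S t x) (RInt (fun s => S s (B x)) 0 t).

Lemma hold_clamp {X : CompleteNormedModule R_AbsRing} (S : R -> X -> X)
    (B : X -> X) t x :
  0 <= t ->
  hold S B t x = plus (S t x) (RInt (fun s => clamp S s (B x)) 0 t).
Proof.
intros Ht; unfold hold; f_equal; apply RInt_ext; intros s.
rewrite Rmin_left, Rmax_right by auto; intros Hs.
rewrite clamp_pos; auto; lra.
Qed.

Lemma hold_plus {X : CompleteNormedModule R_AbsRing} (S : R -> X -> X)
    (B : X -> X) t x y :
  C0_semigroup S -> is_linear B -> 0 <= t ->
  hold S B t (plus x y) = plus (hold S B t x) (hold S B t y).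
Proof.
intros HS HB Ht; rewrite !hold_clamp by auto.
rewrite (lin_plus (S t)) by (apply (C0_linear _ HS); auto).
rewrite (RInt_ext (fun s => clamp S s (B (plus x y)))
  (fun s => plus (clamp S s (B x)) (clamp S s (B y)))).
- rewrite RInt_plus_cont by (intros; apply C0_clamp_cont; auto); module_eq.
- intros s _; rewrite (lin_plus B) by auto.
  apply lin_plus, (C0_linear _ HS), Rmax_l.
Qed.

Lemma hold_norm_le {X : CompleteNormedModule R_AbsRing} (S : R -> X -> X)
    (B : X -> X) t c b x :
  C0_semigroup S -> 0 <= c -> 0 <= t ->
  (forall s y, 0 <= s <= t -> norm (S s y) <= c * norm y) ->
  (forall y, norm (B y) <= b * norm y) ->
  norm (hold S B t x) <= c * (1 + t * b) * norm x.
Proof.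
intros HS Hc Ht Hb HB; rewrite hold_clamp by auto.
eapply Rle_trans; [apply norm_plus_le|].
assert (H1 : norm (RInt (fun s => clamp S s (B x)) 0 t) <=
             (t - 0) * (c * (b * norm x))).
{ apply RInt_norm_le_const; auto.
  - intros; apply C0_clamp_cont; auto.
  - intros s Hs; rewrite clamp_pos by lra.
    eapply Rle_trans; [apply Hb; auto|apply Rmult_le_compat_l; auto]. }
generalize (Hb t x (conj Ht (Rle_refl t))); lra.
Qed.

Lemma hold_minus_norm_le {X : CompleteNormedModule R_AbsRing}
    (S T : R -> X -> X) (B : X -> X) t c b x :
  C0_semigroup S -> C0_semigroup T -> 0 <= c -> 0 <= t ->
  (forall s y, 0 <= s <= t -> norm (minus (S s y) (T s y)) <= c * norm y) ->
  (forall y, norm (B y) <= b * norm y) ->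
  norm (minus (hold S B t x) (hold T B t x)) <= c * (1 + t * b) * norm x.
Proof.
intros HS HT Hc Ht Hb HB; rewrite !hold_clamp by auto.
replace (minus (plus (S t x) (RInt (fun s => clamp S s (B x)) 0 t))
               (plus (T t x) (RInt (fun s => clamp T s (B x)) 0 t)))
  with (plus (minus (S t x) (T t x))
     (minus (RInt (fun s => clamp S s (B x)) 0 t)
            (RInt (fun s => clamp T s (B x)) 0 t))) by module_eq.
assert (HSc : forall s, continuous (fun s => clamp S s (B x)) s)
  by (intros; apply C0_clamp_cont; auto).
assert (HTc : forall s, continuous (fun s => clamp T s (B x)) s)
  by (intros; apply C0_clamp_cont; auto).
rewrite <- RInt_minus_cont by auto.
eapply Rle_trans; [apply norm_plus_le|].
assert (H1 : norm (RInt (fun s => minus (clamp S s (B x)) (clamp T s (B x))) 0 t)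
             <= (t - 0) * (c * (b * norm x))).
{ apply RInt_norm_le_const; auto.
  - intros s; apply (continuous_minus (fun s => clamp S s (B x))); auto.
  - intros s Hs; rewrite !clamp_pos by lra.
    eapply Rle_trans; [apply Hb; auto|apply Rmult_le_compat_l; auto]. }
generalize (Hb t x (conj Ht (Rle_refl t))); lra.
Qed.

Lemma solution_hold {X U : CompleteNormedModule R_AbsRing} tau (S : R -> X -> X)
    (B0 : U -> X) (F : X -> U) x0 x :
  0 < tau -> is_solution tau S B0 F x0 x ->
  let Phi := hold S (fun y => B0 (F y)) in
  forall k, x (INR k * tau) = Nat.iter k (Phi tau) x0 /\
    forall t, 0 < t <= tau ->
      x (INR k * tau + t) = Phi t (Nat.iter k (Phi tau) x0).
Proof.
intros Htau [H0 H] Phi k.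
assert (Hk : x (INR k * tau) = Nat.iter k (Phi tau) x0).
{ induction k as [|k IH].
  - simpl; rewrite Rmult_0_l; auto.
  - replace (INR (Datatypes.S k) * tau) with (INR k * tau + tau)
      by (rewrite S_INR; ring).
    rewrite H, IH by lra; reflexivity. }
split; auto; intros t Ht; rewrite H, Hk by auto; reflexivity.
Qed.

(** [exp_stable] speaks about every solution; one must be exhibited to turn it into a bound on
    powers of the nominal one-period operator. *)
Lemma solution_exists {X U : CompleteNormedModule R_AbsRing} tau
    (S : R -> X -> X) (B0 : U -> X) (F : X -> U) x0 :
  0 < tau -> exists x, is_solution tau S B0 F x0 x.
Proof.
intros Htau; set (Phi := hold S (fun y => B0 (F y))).
(* For [s > 0], [- up (- (s / tau))] is the integer [k] with
   [k tau < s <= (k + 1) tau]. *)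
set (x := fun s => if Rle_dec s 0 then x0 else
  let k := Z.to_nat (- up (- (s / tau))) in
  Phi (s - INR k * tau) (Nat.iter k (Phi tau) x0)).
exists x.
assert (Hx : forall k t, 0 < t <= tau ->
  x (INR k * tau + t) = Phi t (Nat.iter k (Phi tau) x0)).
{ intros k t Ht; unfold x.
  assert (Hk : 0 <= INR k * tau) by (apply Rmult_le_pos; [apply pos_INR|lra]).
  destruct (Rle_dec (INR k * tau + t) 0) as [Hle|_]; [lra|].
  assert (Hup : (- Z.of_nat k)%Z = up (- ((INR k * tau + t) / tau))).
  { replace (- ((INR k * tau + t) / tau)) with (- INR k - t / tau)
      by (field; lra).
    assert (H1 : 0 < t / tau) by (apply Rdiv_lt_0_compat; lra).
    assert (H2 : t / tau <= 1).
    { apply Rmult_le_reg_r with tau; auto.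
      replace (t / tau * tau) with t by (field; lra); lra. }
    apply tech_up; rewrite opp_IZR, <- INR_IZR_INZ; lra. }
  rewrite <- Hup, Z.opp_involutive, Nat2Z.id; cbv zeta; f_equal; ring. }
assert (Hgrid : forall k, x (INR k * tau) = Nat.iter k (Phi tau) x0).
{ intros [|k].
  - unfold x; simpl; rewrite Rmult_0_l.
    destruct (Rle_dec 0 0); [reflexivity|lra].
  - replace (INR (Datatypes.S k) * tau) with (INR k * tau + tau)
      by (rewrite S_INR; ring).
    rewrite Hx by lra; reflexivity. }
split.
- rewrite <- (Rmult_0_l tau); exact (Hgrid O).
- intros k t Ht; rewrite Hx, Hgrid by auto; reflexivity.
Qed.

Lemma exp_INR_mult k a : exp (INR k * a) = exp a ^ k.
Proof.
induction k as [|k IH]; [simpl; rewrite Rmult_0_l; apply exp_0|].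
rewrite S_INR, Rmult_plus_distr_r, Rmult_1_l, exp_plus, IH; simpl; ring.
Qed.

(* Bounding [P^j Q^k] rather than [Q^k] makes the induction close with the same
   constant [M]. *)
Lemma perturbed_power_bound {X : CompleteNormedModule R_AbsRing} (P Q : X -> X)
    (M rho eta : R) :
  (forall x y, P (plus x y) = plus (P x) (P y)) ->
  0 <= M -> 0 <= rho -> 0 <= eta ->
  (forall j x, norm (Nat.iter j P x) <= M * rho ^ j * norm x) ->
  (forall x, norm (minus (Q x) (P x)) <= eta * norm x) ->
  forall k x, norm (Nat.iter k Q x) <= M * (rho + M * eta) ^ k * norm x.
Proof.
intros HP HM Hrho Heta HPj HQP.
assert (HPadd : forall j x y,
  Nat.iter j P (plus x y) = plus (Nat.iter j P x) (Nat.iter j P y)).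
{ induction j as [|j IH]; intros x y; simpl; [|rewrite IH, HP]; reflexivity. }
set (r := rho + M * eta).
assert (Hkj : forall k j x, norm (Nat.iter j P (Nat.iter k Q x))
                            <= M * rho ^ j * r ^ k * norm x).
{ induction k as [|k IH]; intros j x.
  - simpl; rewrite Rmult_1_r; apply HPj.
  - set (y := Nat.iter k Q x).
    change (Nat.iter (Datatypes.S k) Q x) with (Q y).
    (* [P y] raises the power of [P] by one, giving the factor [rho]; the defect, estimated with the
       case [j = 0] of the induction hypothesis, gives [M * eta]. *)
    replace (Q y) with (plus (P y) (minus (Q y) (P y))) by module_eq.
    rewrite HPadd, <- Nat.iter_succ_r.
    eapply Rle_trans; [apply norm_plus_le|].
    assert (Hy := IH O x); simpl in Hy; fold y in Hy.
    assert (H1 := IH (Datatypes.S j) x); fold y in H1.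
    assert (H2 : norm (Nat.iter j P (minus (Q y) (P y)))
                 <= M * rho ^ j * (eta * (M * 1 * r ^ k * norm x))).
    { eapply Rle_trans; [apply HPj|].
      apply Rmult_le_compat_l; [apply Rmult_le_pos; auto; apply pow_le; auto|].
      eapply Rle_trans; [apply HQP|apply Rmult_le_compat_l; auto]. }
    eapply Rle_trans; [apply Rplus_le_compat; [apply H1|apply H2]|].
    replace (r ^ Datatypes.S k) with ((rho + M * eta) * r ^ k) by reflexivity.
    right; simpl; ring. }
intros k x; generalize (Hkj k O x); simpl; rewrite Rmult_1_r; auto.
Qed.

Lemma hold_power_bound {X : CompleteNormedModule R_AbsRing} (S T : R -> X -> X)
    (B : X -> X) (tau b d M rho : R) :
  C0_semigroup S -> C0_semigroup T -> is_linear B ->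
  0 <= tau -> 0 <= b -> 0 <= d -> 0 <= M -> 0 <= rho ->
  (forall y, norm (B y) <= b * norm y) ->
  (forall s y, 0 <= s <= tau -> norm (minus (S s y) (T s y)) <= d * norm y) ->
  (forall j x, norm (Nat.iter j (hold T B tau) x) <= M * rho ^ j * norm x) ->
  forall k x, norm (Nat.iter k (hold S B tau) x) <=
    M * (rho + M * (d * (1 + tau * b))) ^ k * norm x.
Proof.
intros HS HT HB Htau Hb Hd HM Hrho HBb HST HTj.
assert (Htb : 0 <= tau * b) by (apply Rmult_le_pos; auto).
apply (perturbed_power_bound (hold T B tau)); auto.
- intros x y; apply hold_plus; auto.
- apply Rmult_le_pos; lra.
- intros x; apply hold_minus_norm_le; auto.
Qed.

(** Rounding through [up] of the negated quotient puts the remainder in [(0, tau]], the convention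
    of [is_solution], rather than in [[0, tau)]. *)
Lemma time_grid tau t : 0 < tau -> 0 < t ->
  exists k r, 0 < r <= tau /\ t = INR k * tau + r.
Proof.
intros Htau Ht; destruct (archimed (- (t / tau))) as [H1 H2].
set (u := up (- (t / tau))) in *.
assert (Hq : 0 < t / tau) by (apply Rdiv_lt_0_compat; auto).
assert (Hu : (u <= 0)%Z).
{ apply Z.lt_succ_r, lt_IZR; simpl; lra. }
exists (Z.to_nat (- u)), (t + IZR u * tau).
rewrite INR_IZR_INZ, Z2Nat.id, opp_IZR by lia.
assert (E : t = t / tau * tau) by (field; lra).
split; [|ring].
assert (H3 : 0 < (t / tau + IZR u) * tau) by (apply Rmult_lt_0_compat; lra).
assert (H4 : (t / tau + IZR u) * tau <= 1 * tau) by (apply Rmult_le_compat_r; lra).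
rewrite Rmult_plus_distr_r, <- E in H3, H4; lra.
Qed.

End Robustness.

(** * Choice of the smallness constant and transfer of the decay rate *)

Theorem theorem1p2
    (X U : CompleteNormedModule R_AbsRing) (tau : R) (htau : 0 < tau)
    (A : operator X) (T : R -> X -> X)
    (hT : C0_semigroup T) (hA : is_generator A T)
    (B0 : U -> X) (hB0 : is_linear B0) (F : X -> U) (hF : is_linear F)
    (omega : R) (hstab : exp_stable tau T B0 F omega)
    (t0 : R) (ht0 : 0 < t0) :
  exists q : R, 0 < q < 1 /\
    forall D : X -> X, is_linear_X1 A D ->
      (forall x, op_dom A x ->
         RInt (fun s => norm (D (T s x))) 0 t0 <= q * norm x) ->
      exists TD : R -> X -> X,
        C0_semigroup TD /\ is_generator (perturb A D) TD /\
        exp_stable tau TD B0 F omega.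
Proof.
set (B := fun y => B0 (F y)).
assert (HB : is_linear B) by exact (is_linear_comp F B0 hF hB0).
destruct (linear_norm B HB) as (b & Hb & HBb).
destruct hstab as (M0 & omega' & HM0 & Homega & Hstab).
destruct (miyadera_voigt A T t0 hT hA ht0) as (lambda & M & Hlambda & HM & HMV).
set (P := hold T B tau).
set (rho := exp (- omega' * tau)).
(* The stability hypothesis read at the sampling times [j tau] only. *)
assert (HPj : forall j x, norm (Nat.iter j P x) <= M0 * rho ^ j * norm x).
{ intros j x; destruct (solution_exists tau T B0 F x htau) as [u Hu].
  replace (Nat.iter j P x) with (u (INR j * tau))
    by exact (proj1 (solution_hold tau T B0 F x u htau Hu j)).
  eapply Rle_trans; [apply (Hstab x u Hu)|].
  - apply Rmult_le_pos; [apply pos_INR|lra].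
  - right; unfold rho; rewrite <- exp_INR_mult.
    replace (INR j * (- omega' * tau)) with (- omega' * (INR j * tau)) by ring.
    reflexivity. }
(* The gap between [omega2] and [omega'] pays for the perturbation, and the one between [omega] and
   [omega2] keeps the rate strictly above [omega]. *)
set (omega2 := (omega + omega') / 2).
assert (Homega2 : omega < omega2 < omega') by (unfold omega2; lra).
set (rho2 := exp (- omega2 * tau)).
assert (Hrho : rho < rho2).
{ apply exp_increasing, Rmult_lt_compat_r; lra. }
assert (Hrho0 : 0 < rho) by apply exp_pos.
assert (Htb : 0 < tau * b) by (apply Rmult_lt_0_compat; auto).
(* [kappa * q] bounds [S s - T s] for all [s] in [[0, tau]]. *)
set (kappa := exp (lambda * tau) * (4 * M)).
assert (Hkappa : 0 < kappa).
{ apply Rmult_lt_0_compat; [apply exp_pos|lra]. }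
assert (Hden : 0 < M0 * (kappa * (1 + tau * b)))
  by (apply Rmult_lt_0_compat; [|apply Rmult_lt_0_compat]; lra).
(* The first entry is the requirement of [miyadera_voigt]; the second makes the perturbed power
   bound at most [rho2]. *)
set (q := Rmin (1 / 4) ((rho2 - rho) / (M0 * (kappa * (1 + tau * b))))).
assert (Hq0 : 0 < q)
  by (apply Rmin_pos; [lra|apply Rdiv_lt_0_compat; lra]).
assert (Hq4 : q <= 1 / 4) by apply Rmin_l.
assert (Hrho2 : rho + M0 * (kappa * q * (1 + tau * b)) <= rho2).
{ assert (H : M0 * (kappa * (1 + tau * b)) * q <= rho2 - rho).
  { apply Rle_trans with (M0 * (kappa * (1 + tau * b)) *
      ((rho2 - rho) / (M0 * (kappa * (1 + tau * b))))).
    - apply Rmult_le_compat_l; [lra|apply Rmin_r].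
    - right; field; lra. }
  lra. }
exists q; split; [lra|]; intros D HD Hq.
destruct (HMV D q HD) as (S & HS & HG & HST); [lra|exact Hq|].
exists S; split; [|split]; auto.
(* [c] depends on [D], as the stability constant may; it serves only inside the last, incomplete
   period. *)
destruct (C0_bounded S tau HS) as (c & Hc & HSc).
assert (HQk : forall k x,
  norm (Nat.iter k (hold S B tau) x) <= M0 * rho2 ^ k * norm x).
{ assert (Hkq : 0 <= kappa * q) by (apply Rmult_le_pos; lra).
  intros k x; eapply Rle_trans;
    [apply (hold_power_bound S T B tau b (kappa * q) M0 rho); auto; try lra|].
  - intros s y Hs; eapply Rle_trans; [apply HST; lra|].
    apply Rmult_le_compat_r; [apply norm_ge_0|].
    unfold kappa; rewrite !Rmult_assoc; apply Rmult_le_compat_r;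
      [repeat apply Rmult_le_pos; lra|].
    apply exp_nondecreasing, Rmult_le_compat_l; lra.
  - apply Rmult_le_compat_r; [apply norm_ge_0|].
    apply Rmult_le_compat_l; [lra|apply pow_incr; split; auto].
    generalize (Rmult_le_pos _ _ Hkq (Rlt_le _ _ (Rplus_lt_0_compat _ _ Rlt_0_1 Htb))).
    intros H; generalize (Rmult_le_pos M0 _ ltac:(lra) H); lra. }
set (C := c * (1 + tau * b)).
assert (HC : 1 <= C).
{ unfold C; rewrite <- (Rmult_1_r 1); apply Rmult_le_compat; lra. }
(* Absorbs [exp (omega2 * r)] for the remainder [r <= tau], whatever the sign of [omega2]. *)
set (E := exp (Rabs omega2 * tau)).
assert (HE : 1 <= E).
{ generalize (exp_ineq1_le (Rabs omega2 * tau)).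
  generalize (Rmult_le_pos _ _ (Rabs_pos omega2) (Rlt_le _ _ htau)).
  unfold E; lra. }
assert (HCE : 1 <= C * E).
{ rewrite <- (Rmult_1_r 1); apply Rmult_le_compat; lra. }
exists (M0 * (C * E)), omega2.
split; [rewrite <- (Rmult_1_r 1); apply Rmult_le_compat; lra|].
split; [lra|]; intros x0 x Hx t Ht.
destruct (Req_dec t 0) as [->|Ht0].
{ rewrite (proj1 Hx), Rmult_0_r, exp_0, Rmult_1_r.
  rewrite <- (Rmult_1_l (norm x0)) at 1.
  apply Rmult_le_compat_r; [apply norm_ge_0|].
  rewrite <- (Rmult_1_r 1); apply Rmult_le_compat; lra. }
destruct (time_grid tau t htau) as (k & r & Hr & ->); [lra|].
destruct (solution_hold tau S B0 F x0 x htau Hx k) as [_ Hkr].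
rewrite Hkr by auto.
set (z := Nat.iter k _ x0).
assert (Hz : norm z <= M0 * rho2 ^ k * norm x0) by apply HQk.
assert (H1 : norm (hold S B r z) <= C * norm z).
{ eapply Rle_trans; [apply (hold_norm_le S B r c b)|]; auto; try lra.
  - intros s y Hs; apply HSc; lra.
  - apply Rmult_le_compat_r; [apply norm_ge_0|]; unfold C.
    apply Rmult_le_compat_l; [lra|].
    apply Rplus_le_compat_l, Rmult_le_compat_r; lra. }
assert (H2 : rho2 ^ k <= E * exp (- omega2 * (INR k * tau + r))).
{ unfold rho2, E; rewrite <- exp_INR_mult, <- exp_plus; apply exp_nondecreasing.
  assert (H : omega2 * r <= Rabs omega2 * tau).
  { apply Rle_trans with (Rabs omega2 * r).
    - apply Rmult_le_compat_r; [lra|apply Rle_abs].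
    - apply Rmult_le_compat_l; [apply Rabs_pos|lra]. }
  lra. }
eapply Rle_trans; [apply H1|].
apply Rle_trans with (C * (M0 * (E * exp (- omega2 * (INR k * tau + r))) * norm x0)).
- apply Rmult_le_compat_l; [lra|].
  eapply Rle_trans; [apply Hz|].
  apply Rmult_le_compat_r; [apply norm_ge_0|].
  apply Rmult_le_compat_l; lra.
- right; ring.
Qed.
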